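(* Let $N$ be an integer with $2\le N\le 49$, let $p=(p_1,\dots,p_N)$ consist of the first $N$ entries of the fixed list of moduli given in the context (these are pairwise coprime and satisfy $p_\ell\le 256$), and assume $k\le 2^{17}$. Put $\mathcal P:=\prod_{\ell=1}^N p_\ell$ and $\rho:=\sum_{\ell=1}^N\lfloor p_\ell/2\rfloor$. Let $b\in\{32,64\}$, $A\in\mathbb F_b^{m\times k}$, $B\in\mathbb F_b^{k\times n}$, and let $C_b$ be the result of procedure OS_II$(A,B,p)$ (defined in the context). Assume that $A(i,:)\ne\mathbf 0^T$ for $1\le i\le m$ and $B(:,j)\ne\mathbf 0$ for $1\le j\le n$ (no row of $A$ and no column of $B$ is zero). Let $A',B',\bar C$ be the matrices computed in procedure Scaling$(A,B,p)$ (defined in the context). Define $\alpha'\in\mathbb R^m$, $\beta'\in\mathbb R^n$ by $\alpha':=\alpha+\tfrac12 e'$ and $\beta':=\beta+\tfrac12 f'$, where $$\alpha_i:=\Big\lfloor\log_2\max_{1\le h\le k}|a_{ih}|\Big\rfloor,\quad e'_i:=\log_2\max_{1\le h\le n}\bar c_{ih},\quad \beta_j:=\Big\lfloor\log_2\max_{1\le h\le k}|b_{hj}|\Big\rfloor,\quad f'_j:=\log_2\max_{1\le h\le m}\bar c_{hj}.$$ Let $$R_{32}:=(1+u_{32})(N+2)u_{64}\,\rho\,\mathcal P E+u_{32}|A'B'|,$$ $$R_{64}:=(1+3u_{64})2^{1+\lceil\log_2\rho\rceil}(N+2)u_{64}^2\,\rho\,\mathcal P E+3u_{64}|A'B'|.$$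 Then, with $v=(1,1,\dots,1)^T\in\mathbb Z^k$ and $t:=1/\sqrt{2^5(\mathcal P-1)}$, the following entrywise inequality holds: $$|AB-C_b|\le t\,|A|\,v\,(2^{\beta'})^T+t\,2^{\alpha'}v^T|B|+(kE+R_b)\circ t^2\,2^{\alpha'}(2^{\beta'})^T,$$ where $\circ$ denotes elementwise multiplication.
   Context: **Notation.** $\mathbb F_{32},\mathbb F_{64}$ are the sets of single- and double-precision floating-point numbers (FP32, FP64), with unit roundoffs $u_{32}=2^{-24}$, $u_{64}=2^{-53}$. $E$ is the all-ones matrix of appropriate size ($m\times n$ in the claim). Inequalities, absolute values, $2^X$, $\lceil X\rceil$, trunc, mod, round, etc. applied to matrices or vectors are entrywise; $2^{\alpha'}$ and $2^{\beta'}$ are column vectors. $\mathrm{diag}(x)$ is the diagonal matrix with diagonal $x$. $\mathrm{round}(x)$ rounds $x$ to the nearest integer, $\mathrm{trunc}(x)$ is the integer part of $x$. For $x\in\mathbb Z$, $q\in\mathbb N$: $\mathrm{mod}(x,q):=x-q\cdot\mathrm{round}(x/q)$, so $|\mathrm{mod}(x,q)|\le\lfloor q/2\rfloor$. $\mathrm{double}(x)$ and $\mathrm{single}(x)$ round the real number $x$ to nearest-even in $\mathbb F_{64}$, resp. $\mathbb F_{32}$; $\mathrm{single}_{\bigtriangledown}$, $\mathrm{single}_{\bigtriangleup}$ round to $\mathbb F_{32}$ downward, resp. upward. $\mathrm{fl}(\cdot)$, $\mathrm{fl}_{\bigtriangledown}(\cdot)$ mean that all operations inside are computed in floating-point arithmetic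 with round-to-nearest-even, resp. round-down. $\mathrm{fma}(x,y,z)$ computes $xy+z$ by a fused multiply-add. For $x\in\mathbb F_{32}$, $\mathrm{log2f}(x)$ is the result of computing $\log_2x$ in FP32, assumed to satisfy $|\mathrm{log2f}(x)-\log_2x|\le 4u_{32}\log_2x$. **List of moduli.** $256, 255, 253, 251, 247, 241, 239, 233, 229, 227, 223, 217, 211, 199, 197, 193, 191, 181, 179, 173, 167, 163, 157, 151, 149, 139, 137, 131, 127, 113, 109, 107, 103, 101, 97, 89, 83, 79, 73, 71, 67, 61, 59, 53, 47, 43, 41, 37, 29$ (49 entries). **Procedure Scaling$(A,B,p)$** (output $A',B',\mu,\nu$), for $A\in\mathbb F_b^{m\times k}$, $B\in\mathbb F_b^{k\times n}$: 1. $\mathcal P':=\mathrm{single}_{\bigtriangledown}\big(\tfrac12\log_2(\mathcal P-1)-0.5\big)$. 2. $\mu'_i:=5-\lfloor\log_2\max_h|a_{ih}|\rfloor$, $\nu'_j:=5-\lfloor\log_2\max_h|b_{hj}|\rfloor$. 3. $\bar A:=\lceil\mathrm{diag}(2^{\mu'})|A|\rceil$, $\bar B:=\lceil|B|\,\mathrm{diag}(2^{\nu'})\rceil$ (integer matrices with entries in $[0,2^6]$). 4. $\bar C:=\bar A\bar B$ (exact integer product, entries at most $2^{29}$), $\bar D:=\mathrm{single}_{\bigtriangleup}(\bar C)$. 5. $e_i:=\mathrm{log2f}(\max_h\bar d_{ih})$, $f_j:=\mathrm{log2f}(\max_h\bar d_{hj})$. 6. With $c_0:=\mathrm{single}_{\bigtriangledown}(-0.5/(1-4u_{32}))$: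 $\mu_i:=\mu'_i+\mathrm{fl}_{\bigtriangledown}(\lfloor\mathrm{fma}(c_0,e_i,\mathcal P')\rfloor)$, $\nu_j:=\nu'_j+\mathrm{fl}_{\bigtriangledown}(\lfloor\mathrm{fma}(c_0,f_j,\mathcal P')\rfloor)$ (in FP32). 7. $A':=\mathrm{trunc}(\mathrm{diag}(2^\mu)A)$, $B':=\mathrm{trunc}(B\,\mathrm{diag}(2^\nu))$ (integer matrices with entries in $\mathbb F_b$). **Constants.** $q_\ell\in\mathbb N$, $q_\ell<p_\ell$, is the inverse of $\mathcal P/p_\ell$ modulo $p_\ell$. $\mathcal P_1:=\mathrm{double}(\mathcal P)$; $\mathcal P_2:=0$ if $b=32$ and $\mathcal P_2:=\mathrm{double}(\mathcal P-\mathcal P_1)$ if $b=64$; $\mathcal P_{inv}:=\mathrm{double}(\mathcal P^{-1})$. If $b=32$: $s_{\ell1}:=\mathrm{double}(\tfrac{\mathcal P}{p_\ell}q_\ell)$, $s_{\ell2}:=0$. If $b=64$: $s_{\ell1}$ retains only the upper $\beta_\ell$ bits of $\tfrac{\mathcal P}{p_\ell}q_\ell$, where $\beta_\ell:=53-\lceil\log_2\rho\rceil+\lfloor\log_2\tfrac{\mathcal P}{p_\ell}q_\ell\rfloor-\lfloor\log_2\max_{1\le h\le N}\tfrac{\mathcal P}{p_h}q_h\rfloor$, and $s_{\ell2}:=\mathrm{double}(\tfrac{\mathcal P}{p_\ell}q_\ell-s_{\ell1})$. (These integers $\beta_\ell$ are unrelated to the vector $\beta$ in the claim.) **Procedure CRT$(A',B',p)$**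 (output $C''$): 1. $A'_\ell:=\mathrm{mod}(A',p_\ell)$, $B'_\ell:=\mathrm{mod}(B',p_\ell)$ stored as 8-bit signed integers (for $p_\ell=256$ the value $128$ is stored as $-128$). 2. $C'_\ell:=A'_\ell B'_\ell$ in 32-bit signed integers (exact, except that for $p_\ell=256$ the value $2^{31}$ wraps to $-2^{31}$). 3. $W_\ell:=\mathrm{mod}(C'_\ell,p_\ell)$, stored as 8-bit signed integers (again $128$ stored as $-128$ when $p_\ell=256$). 4. $C'^{(1)}:=\mathrm{fl}(\sum_{\ell=1}^Ns_{\ell1}W_\ell)$, $C'^{(2)}:=\mathrm{fl}(\sum_{\ell=1}^Ns_{\ell2}W_\ell)$ in FP64. 5. $Q:=\mathrm{round}(\mathrm{fl}(\mathcal P_{inv}\cdot C'^{(1)}))$ in FP64. 6. $C'':=\mathrm{fl}\big(\mathrm{fma}(-Q,\mathcal P_2,\ \mathrm{fma}(-Q,\mathcal P_1,C'^{(1)})+C'^{(2)})\big)$ in FP64, entrywise. 7. If $b=32$, replace $C''$ by $\mathrm{single}(C'')$. **Procedure OS_II$(A,B,p)$:** compute $[A',B',\mu,\nu]:=$ Scaling$(A,B,p)$, then $C'':=$ CRT$(A',B',p)$, and return $C:=\mathrm{fl}(\mathrm{diag}(2^{-\mu})\,C''\,\mathrm{diag}(2^{-\nu}))\in\mathbb F_b^{m\times n}$.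
   Formalization: FP32 and FP64 are taken as 24- and 53-bit binary numbers with unbounded exponent (no overflow or underflow); with bounded exponents the claim fails, e.g. b=32, N=10, A=B=2^-100 gives C=0 while the bound is below AB. *)

(* Defs.v *)
From HB Require Import structures.
From mathcomp Require Export all_boot all_order all_algebra.
From mathcomp Require Export reals exp.

Set Implicit Arguments.
Unset Strict Implicit.
Unset Printing Implicit Defensive.

Import Order.TTheory GRing.Theory Num.Theory.
Local Open Scope ring_scope.

Section Rounding.
Variable R : realType.
Implicit Types (x y z : R) (p : nat).

Definition log2 x : R := ln x / ln 2.

Definition rtrunc x : int := if 0 <= x then Num.floor x else Num.ceil x.

(* Both "nearest integer" conventions for ties (to even, away from zero) are
   instances; the ties of the integer-valued round are left open. *)
Definition nearest_int (rint : R -> int) : Prop :=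
  forall x, `|x - (rint x)%:~R| <= 1 / 2.

Definition rne x : int :=
  let f := Num.floor x in
  let d := x - f%:~R in
  if d < 1 / 2 then f
  else if 1 / 2 < d then f + 1
  else if (2 %| f)%Z then f else f + 1.

(* Binary floating-point numbers with p significant bits and unbounded exponent:
   neither overflow nor underflow. *)
Definition is_fp p x : Prop :=
  exists m e : int, (`|m| < 2 ^+ p) /\ x = m%:~R * 2 ^ e.

(* For x != 0, x / 2 ^ e has absolute value in [2 ^ (q - 1), 2 ^ q), so that
   rounding it to an integer rounds x to q significant bits; 0 is mapped to 0. *)
Definition fround (rnd : R -> int) (q : int) x : R :=
  let e := Num.floor (log2 `|x|) - q + 1 in
  (rnd (x / 2 ^ e))%:~R * 2 ^ e.

Inductive format := FP32 | FP64.

Definition prec (b : format) : nat := if b is FP32 then 24%N else 53%N.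

Definition unit_roundoff (b : format) : R := 2 ^- prec b.

Definition fl (b : format) x : R := fround rne (prec b)%:Z x.
Definition fl_down (b : format) x : R :=
  fround (fun y => Num.floor y) (prec b)%:Z x.
Definition fl_up (b : format) x : R :=
  fround (fun y => Num.ceil y) (prec b)%:Z x.

Definition fma b x y z : R := fl b (x * y + z).
Definition fma_down b x y z : R := fl_down b (x * y + z).

(* The error bound is only satisfiable where log2 x >= 0. No value is prescribed
   for log2f 0. *)
Definition log2f_accurate (log2f : R -> R) : Prop :=
  forall x, is_fp (prec FP32) x -> 1 <= x ->
    is_fp (prec FP32) (log2f x) /\
    `|log2f x - log2 x| <= 4 * unit_roundoff FP32 * log2 x.

End Rounding.

Arguments unit_roundoff {R} b.

(* An order of evaluation for a floating-point sum. *)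
Inductive sum_tree (I : Type) :=
  | Leaf of I
  | Node of sum_tree I & sum_tree I.

Fixpoint leaves I (T : sum_tree I) : seq I :=
  match T with
  | Leaf i => [:: i]
  | Node T1 T2 => leaves T1 ++ leaves T2
  end.

Definition sum_order N (T : sum_tree 'I_N) : Prop :=
  perm_eq (leaves T) (enum 'I_N).

Fixpoint fl_sum (R : realType) b I (T : sum_tree I) (F : I -> R) : R :=
  match T with
  | Leaf i => F i
  | Node T1 T2 => fl b (fl_sum b T1 F + fl_sum b T2 F)
  end.

Definition moduli : seq nat :=
  [:: 256; 255; 253; 251; 247; 241; 239; 233; 229; 227; 223; 217; 211; 199;
      197; 193; 191; 181; 179; 173; 167; 163; 157; 151; 149; 139; 137; 131;
      127; 113; 109; 107; 103; 101; 97; 89; 83; 79; 73; 71; 67; 61; 59; 53;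
      47; 43; 41; 37; 29]%N.

Definition modulus (l : nat) : nat := nth 0%N moduli l.

Definition Pprod (N : nat) : nat := (\prod_(l < N) modulus l)%N.

Definition rho (N : nat) : nat := (\sum_(l < N) modulus l %/ 2)%N.

Section Matrices.
Variable R : realType.
Variables m n : nat.
Implicit Types M : 'M[R]_(m, n).

Definition absmx M : 'M[R]_(m, n) := map_mx (fun x => `|x|) M.

Definition intmx (M : 'M[int]_(m, n)) : 'M[R]_(m, n) :=
  map_mx (fun z => z%:~R) M.

Definition hadamard M1 M2 : 'M[R]_(m, n) := map2_mx *%R M1 M2.

(* Maxima of rows and columns of nonnegative matrices, whence the seed 0. *)
Definition rowmax M (i : 'I_m) : R := \big[Num.max/0]_h M i h.
Definition colmax M (j : 'I_n) : R := \big[Num.max/0]_h M h j.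

Definition pow2 (x : 'cV[R]_n) : 'cV[R]_n := map_mx (fun y => 2 `^ y) x.

End Matrices.

Arguments intmx R {m n} M.

Section Scaling.
Variables (R : realType) (log2f : R -> R) (N m k n : nat).
Variables (A : 'M[R]_(m, k)) (B : 'M[R]_(k, n)).

Definition Pscale : R :=
  fl_down FP32 (1 / 2 * log2 ((Pprod N)%:R - 1) - 1 / 2).

Definition mu' (i : 'I_m) : int := 5 - Num.floor (log2 (rowmax (absmx A) i)).
Definition nu' (j : 'I_n) : int := 5 - Num.floor (log2 (colmax (absmx B) j)).

Definition Abar : 'M[int]_(m, k) :=
  \matrix_(i, h) Num.ceil (2 ^ mu' i * `|A i h|).
Definition Bbar : 'M[int]_(k, n) :=
  \matrix_(h, j) Num.ceil (`|B h j| * 2 ^ nu' j).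

Definition Cbar : 'M[int]_(m, n) := Abar *m Bbar.

Definition Dbar : 'M[R]_(m, n) := map_mx (@fl_up R FP32) (intmx R Cbar).

Definition elog (i : 'I_m) : R := log2f (rowmax Dbar i).
Definition flog (j : 'I_n) : R := log2f (colmax Dbar j).

Definition c0 : R := fl_down FP32 (- (1 / 2) / (1 - 4 * unit_roundoff FP32)).

(* The floor of an FP32 number is an FP32 number, so floating-point arithmetic
   computes it exactly. *)
Definition mu (i : 'I_m) : int :=
  mu' i + Num.floor (fma_down FP32 c0 (elog i) Pscale).
Definition nu (j : 'I_n) : int :=
  nu' j + Num.floor (fma_down FP32 c0 (flog j) Pscale).

Definition Aint : 'M[int]_(m, k) := \matrix_(i, h) rtrunc (2 ^ mu i * A i h).
Definition Bint : 'M[int]_(k, n) := \matrix_(h, j) rtrunc (B h j * 2 ^ nu j).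

End Scaling.

Section Constants.
Variables (R : realType) (b : format) (N : nat).
Implicit Types l : 'I_N.

Definition qinv l : nat :=
  find (fun q => (Pprod N %/ modulus l * q == 1 %[mod modulus l])%N)
       (iota 0 (modulus l)).

Definition crt_weight l : nat := (Pprod N %/ modulus l * qinv l)%N.

Definition P1 : R := fl FP64 (Pprod N)%:R.
Definition P2 : R := if b is FP32 then 0 else fl FP64 ((Pprod N)%:R - P1).
Definition Pinv : R := fl FP64 ((Pprod N)%:R^-1).

Definition nbits l : int :=
  53 - Num.ceil (log2 ((rho N)%:R : R))
  + Num.floor (log2 ((crt_weight l)%:R : R))
  - Num.floor (log2 ((\max_(h < N) crt_weight h)%:R : R)).

Definition s1 l : R :=
  if b is FP32 then fl FP64 (crt_weight l)%:R
  else fround (fun y => Num.floor y) (nbits l) (crt_weight l)%:R.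

Definition s2 l : R :=
  if b is FP32 then 0 else fl FP64 ((crt_weight l)%:R - s1 l).

End Constants.

(* Two's-complement wrap-around into w bits: int_wrap 8 128 = - 128. *)
Definition int_wrap (w : nat) (z : int) : int :=
  ((z + 2 ^+ w.-1) %% (2 ^+ w))%Z - 2 ^+ w.-1.

Section CRT.
Variables (R : realType) (rint : R -> int) (b : format) (N m k n : nat).
Variables (T1 T2 : sum_tree 'I_N).
Variables (A' : 'M[int]_(m, k)) (B' : 'M[int]_(k, n)).
Implicit Types l : 'I_N.

Definition cmod (z : int) (q : nat) : int :=
  z - q%:Z * rint (z%:~R / q%:R).

Definition Amod l : 'M[int]_(m, k) :=
  map_mx (fun z => int_wrap 8 (cmod z (modulus l))) A'.
Definition Bmod l : 'M[int]_(k, n) :=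
  map_mx (fun z => int_wrap 8 (cmod z (modulus l))) B'.
Definition Cmod l : 'M[int]_(m, n) := map_mx (int_wrap 32) (Amod l *m Bmod l).

Definition W l : 'M[int]_(m, n) :=
  map_mx (fun z => int_wrap 8 (cmod z (modulus l))) (Cmod l).

Definition C1 : 'M[R]_(m, n) :=
  \matrix_(i, j) fl_sum FP64 T1 (fun l => fl FP64 (s1 R b l * (W l i j)%:~R)).
Definition C2 : 'M[R]_(m, n) :=
  \matrix_(i, j) fl_sum FP64 T2 (fun l => fl FP64 (s2 R b l * (W l i j)%:~R)).

Definition Q : 'M[int]_(m, n) :=
  \matrix_(i, j) rint (fl FP64 (Pinv R N * C1 i j)).

Definition CRT64 : 'M[R]_(m, n) :=
  \matrix_(i, j)
    fma FP64 (- (Q i j)%:~R) (P2 R b N)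
      (fl FP64 (fma FP64 (- (Q i j)%:~R) (P1 R N) (C1 i j) + C2 i j)).

Definition CRT : 'M[R]_(m, n) :=
  if b is FP32 then map_mx (@fl R FP32) CRT64 else CRT64.

End CRT.

(* A sum over l = 1..N may be evaluated in any order: T1 and T2 give the orders
   for the two sums of CRT. *)
Definition OS_II (R : realType) (rint : R -> int) (log2f : R -> R)
    (b : format) (N m k n : nat) (T1 T2 : sum_tree 'I_N)
    (A : 'M[R]_(m, k)) (B : 'M[R]_(k, n)) : 'M[R]_(m, n) :=
  let C'' := CRT rint b T1 T2 (Aint log2f N A B) (Bint log2f N A B) in
  \matrix_(i, j)
    fl b (fl b (2 ^ (- mu log2f N A B i) * C'' i j)
          * 2 ^ (- nu log2f N A B j)).

Section Bound.
Variables (R : realType) (N m k n : nat).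
Variables (A : 'M[R]_(m, k)) (B : 'M[R]_(k, n)).

Definition alpha' : 'cV[R]_m :=
  \col_i ((Num.floor (log2 (rowmax (absmx A) i)))%:~R
          + 1 / 2 * log2 (rowmax (intmx R (Cbar A B)) i)).
Definition beta' : 'cV[R]_n :=
  \col_j ((Num.floor (log2 (colmax (absmx B) j)))%:~R
          + 1 / 2 * log2 (colmax (intmx R (Cbar A B)) j)).

Definition Rbound (b : format) (A' : 'M[int]_(m, k)) (B' : 'M[int]_(k, n))
    : 'M[R]_(m, n) :=
  let u32 : R := unit_roundoff FP32 in
  let u64 : R := unit_roundoff FP64 in
  let E : 'M[R]_(m, n) := const_mx 1 in
  let absA'B' := absmx (intmx R (A' *m B')) in
  match b with
  | FP32 =>
      ((1 + u32) * (N%:R + 2) * u64 * (rho N)%:R * (Pprod N)%:R) *: E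
      + u32 *: absA'B'
  | FP64 =>
      ((1 + 3 * u64) * 2 ^ (1 + Num.ceil (log2 ((rho N)%:R : R)))
         * (N%:R + 2) * u64 ^+ 2 * (rho N)%:R * (Pprod N)%:R) *: E
      + (3 * u64) *: absA'B'
  end.

End Bound.

(* Main.v *)
(* Let P be the product of the moduli, M an entry of A' B', S = sum_l w_l W_l
   the exact Chinese remainder sum, so that S = M + P q for an integer q.
   The exponent shift F chosen for a row whose largest entry of Cbar is c
   satisfies 4 ^ F c (1 + 2 ^ -25) <= (P - 1) / 2, and likewise for columns;
   multiplying the two gives |M| <= (1/2 - 2 ^ -27) P.  The factor 1 + 2 ^ -25
   comes from the downward rounding of c0 when c >= 2; when c = 1 it comes from
   P - 1 not being close to a power of two, which is checked for each N.  As
   C^(1) / P differs from S / P by at most 2 ^ -28, the computed quotient Q is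
   exactly q, and C'' - M is a sum of rounding errors only.  First-order terms
   give the stated coefficients; second-order terms and the roundings that the
   coefficients do not account for are absorbed because w_l <= P (1 - 1 / p_l)
   instead of P.  The scaling itself leaves a factor 2 of room in
   2 ^ - mu_i <= t 2 ^ alpha'_i.  Where Cbar vanishes, no exponent is
   controlled, but then the entries of A B, A' B' and C are all 0. *)
Require Import Defs.
From mathcomp Require Import sequences unstable ring lra zify.
From Stdlib Require BinNat.
Set Implicit Arguments.
Unset Strict Implicit.
Unset Printing Implicit Defensive.
Import Order.TTheory GRing.Theory Num.Theory.
Local Open Scope ring_scope.

(** * Base-2 logarithm and rounding *)

Section Log2.
Variable R : realType.
Implicit Types (x y : R) (e : int).

Lemma pow2_gt0 e : 0 < 2 ^ e :> R.
Proof. exact: exprz_gt0. Qed.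

Lemma pow2D e f : 2 ^ (e + f) = 2 ^ e * 2 ^ f :> R.
Proof. by rewrite expfzDr ?pnatr_eq0. Qed.

Lemma pow2B e f : 2 ^ (e - f) = 2 ^ e / 2 ^ f :> R.
Proof. by rewrite pow2D -invr_expz. Qed.

Lemma intr_pow2 n : (2 ^+ n)%:~R = 2 ^+ n :> R.
Proof. by rewrite rmorphXn. Qed.

Lemma ln2_gt0 : 0 < ln 2 :> R.
Proof. by rewrite ln_gt0 ?ltr1n. Qed.

(** From [exp (- 1 / 2) >= 1 - 1 / 2] one gets [exp (1 / 2) <= 2]. *)
Lemma ln2_ge : 1 / 2 <= ln 2 :> R.
Proof.
have h : expR (1 / 2) <= 2 :> R.
  have := expR_ge1Dx (- (1 / 2) : R); rewrite expRN => h.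
  have e0 := expR_gt0 (1 / 2 : R).
  have : expR (1 / 2) * (1 + - (1 / 2)) <= expR (1/2) / expR (1/2) :> R.
    by rewrite ler_pM2l.
  by rewrite divff ?gt_eqF //; lra.
by rewrite -[leLHS]expRK ler_ln // ?posrE ?expR_gt0.
Qed.

Lemma powR_log2 x : 0 < x -> 2 `^ log2 x = x.
Proof.
move=> x0; rewrite /powR pnatr_eq0 /= /log2 divfK ?gt_eqF ?ln2_gt0 //.
by rewrite lnK.
Qed.

Lemma log2_powR x : log2 (2 `^ x) = x.
Proof. by rewrite /log2 ln_powR mulfK // gt_eqF // ln2_gt0. Qed.

Lemma powR_pow2 e : 2 `^ e%:~R = 2 ^ e :> R.
Proof. by rewrite powR_intmul. Qed.

Lemma log2_pow2 e : log2 (2 ^ e) = e%:~R :> R.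
Proof. by rewrite -powR_pow2 log2_powR. Qed.

Lemma ler_log2 x y : 0 < x -> x <= y -> log2 x <= log2 y.
Proof.
move=> x0 xy; rewrite /log2 ler_pM2r ?invr_gt0 ?ln2_gt0 // ler_ln ?posrE //.
exact: lt_le_trans xy.
Qed.

Lemma log2M x y : 0 < x -> 0 < y -> log2 (x * y) = log2 x + log2 y.
Proof. by move=> x0 y0; rewrite /log2 lnM ?posrE // mulrDl. Qed.

Lemma log2_1 : log2 1 = 0 :> R.
Proof. by rewrite /log2 ln1 mul0r. Qed.

Lemma log2_2 : log2 2 = 1 :> R.
Proof. by rewrite /log2 divff // gt_eqF // ln2_gt0. Qed.

Lemma log2_ge0 x : 1 <= x -> 0 <= log2 x.
Proof. by move=> x1; rewrite -log2_1 ler_log2. Qed.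

Lemma log2_floorP x : 0 < x ->
  2 ^ Num.floor (log2 x) <= x < 2 ^ (Num.floor (log2 x) + 1).
Proof.
move=> x0; have /andP[h1 h2] := floor_itv (log2 x).
rewrite -!powR_pow2 /powR pnatr_eq0 /= -[X in _ <= X < _](lnK (x := x)) ?posrE //.
have l0 := ln2_gt0.
by rewrite ler_expR ltr_expR -ler_pdivlMr // -ltr_pdivrMr // h1 h2.
Qed.

Lemma floor_log2_lt x e : 0 < x -> x < 2 ^ e -> Num.floor (log2 x) < e.
Proof.
move=> x0 xe; have /andP[h _] := log2_floorP x0.
by move: (le_lt_trans h xe); rewrite ltr_eXz2l ?ltr1n.
Qed.

Lemma log2_ceil_ge x : 0 < x -> x <= 2 ^ Num.ceil (log2 x).
Proof.
move=> x0; rewrite -[leLHS]powR_log2 // -powR_pow2.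
by rewrite ler_powR ?ler1n // ceil_ge.
Qed.

(** Converts a gain in the exponent into a factor; the slope [1 / 2] comes from [ln2_ge]. *)
Lemma powR2_ge1D x : 0 <= x -> 1 + x / 2 <= 2 `^ x.
Proof.
move=> x0; rewrite /powR pnatr_eq0 /=; apply: le_trans (expR_ge1Dx _).
by rewrite lerD2l ler_wpM2l //; have := ln2_ge; lra.
Qed.

End Log2.

(** * Floating-point rounding with unbounded exponent *)

Section Fround.
Variable R : realType.
Implicit Types (x y : R) (rnd : R -> int) (z e : int) (p : nat).

(** Covers rounding down, up and to nearest even at once: returning the floor or the ceiling is
    enough to fix integers and to preserve integer bounds. *)
Definition adjacent rnd := forall y, rnd y = Num.floor y \/ rnd y = Num.ceil y.

Lemma adjacent_floor : adjacent (fun y => Num.floor y).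
Proof. by left. Qed.

Lemma adjacent_ceil : adjacent (fun y => Num.ceil y).
Proof. by right. Qed.

Lemma rneP y : `|(rne y)%:~R - y| <= 1 / 2 /\
  (rne y = Num.floor y \/ rne y = Num.ceil y).
Proof.
rewrite /rne; have /andP[h1 h2] := floor_itv y.
set f := Num.floor y in h1 h2 *; rewrite intrD /= in h2.
have hc : f%:~R < y -> f + 1 = Num.ceil y.
  by move=> h; apply/esym/ceil_def; rewrite addrK intrD h ltW.
case: ltP => h3; last case: ltP => h4; last case: ifP => _.
- by split; [rewrite ler_norml; apply/andP; split; lra|left].
- by split; [rewrite intrD ler_norml; apply/andP; split; lra|right; apply: hc; lra].
- by split; [rewrite ler_norml; apply/andP; split; lra|left].
- by split; [rewrite intrD ler_norml; apply/andP; split; lra|right; apply: hc; lra].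
Qed.

Lemma adjacent_rne : adjacent (@rne R).
Proof. by move=> y; have [] := rneP y. Qed.

Section Adjacent.
Variables (rnd : R -> int) (hrnd : adjacent rnd).

Lemma adjacent_int z : rnd z%:~R = z.
Proof. by have [->|->] := hrnd z%:~R; rewrite ?intrKfloor ?intrKceil. Qed.

Lemma adjacent_le y z : y <= z%:~R -> rnd y <= z.
Proof.
move=> h; have [->|->] := hrnd y; last by rewrite ceil_le_int.
by rewrite -(@intrKfloor R z) le_floor.
Qed.

Lemma adjacent_ge y z : z%:~R <= y -> z <= rnd y.
Proof.
move=> h; have [->|->] := hrnd y; first by rewrite floor_ge_int.
by rewrite -(@intrKceil R z) le_ceil.
Qed.

Lemma adjacent_norm_le y z : `|y| <= z%:~R -> `|rnd y| <= z.
Proof.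
rewrite !ler_norml => /andP[h1 h2].
by rewrite adjacent_le // adjacent_ge // mulrNz.
Qed.

Lemma adjacent_err y : `|(rnd y)%:~R - y| <= 1.
Proof.
have /andP[h1 h2] := floor_itv y; have /andP[h3 h4] := ceil_itv y.
rewrite intrD /= in h2; rewrite intrB /= in h3.
by have [->|->] := hrnd y; rewrite ler_norml; apply/andP; split; lra.
Qed.

Lemma fround0 q : fround rnd q 0 = 0.
Proof. by rewrite /fround mul0r (adjacent_int 0) mul0r. Qed.

(** [c] is the error of the integer rounding, [1 / 2] to nearest and [1] when directed. It becomes a
    relative error because [2 ^ floor (log2 |x|) <= |x|]. *)
Lemma fround_err (c : R) q x : (forall y, `|(rnd y)%:~R - y| <= c) ->
  `|fround rnd q x - x| <= c * 2 ^ (1 - q) * `|x|.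
Proof.
move=> hc; have c0 : 0 <= c := le_trans (normr_ge0 _) (hc 0).
have [->|x0] := eqVneq x 0; first by rewrite fround0 subrr normr0 mulr0.
rewrite /fround; set e := _ + 1; have e0 := pow2_gt0 R e.
rewrite -[X in _ - X](divfK (lt0r_neq0 e0)) -mulrBl normrM (gtr0_norm e0).
apply: le_trans (_ : c * 2 ^ e <= _); first by rewrite ler_wpM2r // ltW.
rewrite -mulrA ler_wpM2l // /e -addrA addrC [- q + 1]addrC pow2D.
rewrite ler_wpM2l ?(ltW (pow2_gt0 _ _)) //.
by have /andP[] := log2_floorP (x := `|x|) ltac:(by rewrite normr_gt0).
Qed.

Lemma is_fp_pow2 p z e x :
  `|z| <= 2 ^+ p -> (0 < p)%N -> x = z%:~R * 2 ^ e -> is_fp p x.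
Proof.
case: p => // p hz _ ->; have [hz'|hz'] := ltP `|z| (2 ^+ p.+1).
  by exists z, e.
have {hz'}hz : `|z| = 2 ^+ p.+1 by apply/le_anti; rewrite hz.
exists (Num.sg z * 2 ^+ p), (e + 1); split.
  rewrite normrM normrX (ger0_norm (x := 2)) // normr_sg -normr_eq0 hz.
  by rewrite expf_eq0 /= mul1r ltr_eXn2l.
rewrite {1}(numEsg z) hz exprSr [e + 1]addrC pow2D /= !intrM /=.
by rewrite expr1z; ring.
Qed.

Lemma is_fp_fround p x : (0 < p)%N -> is_fp p (fround rnd p x).
Proof.
move=> p0; have [->|x0] := eqVneq x 0.
  by rewrite fround0; exists 0, 0; rewrite mul0r normr0 exprn_gt0.
apply: is_fp_pow2 (erefl _) => //; apply: adjacent_norm_le.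
set e := _ + 1; have e0 := pow2_gt0 R e.
rewrite normrM normfV (gtr0_norm e0) ler_pdivrMr // intr_pow2.
have /andP[_ h] := log2_floorP (x := `|x|) ltac:(by rewrite normr_gt0).
apply/ltW/(lt_le_trans h); rewrite -[_ ^+ p]/(2 ^ p%:Z) -pow2D /e.
by rewrite (_ : _ + _ = p%:Z + (Num.floor (log2 `|x|) - p%:Z + 1)) //; ring.
Qed.

Lemma fround_fp p x : is_fp p x -> fround rnd p x = x.
Proof.
move=> [z [e [hz xE]]]; have [->|x0] := eqVneq x 0; first exact: fround0.
rewrite /fround; set f := _ + 1.
(* The unit [2 ^ f] of the rounding is no coarser than any representation of [x] with [p] bits, so
   [x / 2 ^ f] is an integer and is left unchanged. *)
have fe : f <= e.
  have : Num.floor (log2 `|x|) < p%:Z + e.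
    apply: floor_log2_lt; first by rewrite normr_gt0.
    rewrite xE normrM (gtr0_norm (pow2_gt0 R e)) pow2D ltr_pM2r ?pow2_gt0 //.
    by rewrite -intr_norm -[2 ^ p%:Z]/(2 ^+ p) -intr_pow2 ltr_int.
  rewrite /f; move: (Num.floor _) => g; lia.
have -> : x / 2 ^ f = (z * 2 ^ (e - f))%:~R.
  rewrite xE -mulrA -pow2B intrM; congr (_ * _).
  have : 0 <= e - f by rewrite subr_ge0.
  by case: (e - f) => // d _; rewrite -!exprnP intr_pow2.
rewrite adjacent_int xE intrM -mulrA; congr (_ * _).
have -> : (2 ^ (e - f))%:~R = 2 ^ (e - f) :> R.
  have : 0 <= e - f by rewrite subr_ge0.
  by case: (e - f) => // d _; rewrite -!exprnP intr_pow2.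
by rewrite -pow2D subrK.
Qed.

End Adjacent.

Lemma is_fpZ p e x : is_fp p x -> is_fp p (2 ^ e * x).
Proof. by move=> [z [f [hz ->]]]; exists z, (e + f); rewrite pow2D mulrCA. Qed.

Lemma prec_gt0 b : (0 < prec b)%N.
Proof. by case: b. Qed.

Lemma is_fp_fl b x : is_fp (prec b) (fl b x).
Proof. exact: is_fp_fround adjacent_rne _ _ (prec_gt0 b). Qed.

Lemma fl_fp b x : is_fp (prec b) x -> fl b x = x.
Proof. exact/fround_fp/adjacent_rne. Qed.

Lemma fl0 b : fl b 0 = 0 :> R.
Proof. exact/fround0/adjacent_rne. Qed.

Lemma fl_err b x : `|fl b x - x| <= unit_roundoff b * `|x|.
Proof.
have -> : unit_roundoff b = 1 / 2 * 2 ^ (1 - (prec b)%:Z) :> R.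
  by rewrite pow2B expr1z mulrA mul1r mulVf ?mul1r // pnatr_eq0.
by apply: fround_err adjacent_rne _ _ _ _ => y; have [] := rneP y.
Qed.

Lemma fl_down_err b x : `|fl_down b x - x| <= 2 ^ (1 - (prec b)%:Z) * `|x|.
Proof.
rewrite -[leRHS]mul1r mulrA.
exact/(fround_err adjacent_floor)/adjacent_err/adjacent_floor.
Qed.

Lemma fl_up_err b x : `|fl_up b x - x| <= 2 ^ (1 - (prec b)%:Z) * `|x|.
Proof.
rewrite -[leRHS]mul1r mulrA.
exact/(fround_err adjacent_ceil)/adjacent_err/adjacent_ceil.
Qed.

Lemma is_fp_fl_up b x : is_fp (prec b) (fl_up b x).
Proof. exact: is_fp_fround adjacent_ceil _ _ (prec_gt0 b). Qed.

Lemma fl_down_le b x : fl_down b x <= x.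
Proof.
by rewrite -ler_pdivlMr ?pow2_gt0 // floor_le.
Qed.

Lemma fl_up_ge b x : x <= fl_up b x.
Proof.
by rewrite -ler_pdivrMr ?pow2_gt0 // ceil_ge.
Qed.

Lemma floor_mul_bounds x c : 0 < c ->
  0 <= x - (Num.floor (x / c))%:~R * c <= c.
Proof.
move=> c0; have /andP[h1 h2] := floor_itv (x / c).
rewrite ler_pdivlMr // in h1; rewrite intrD ltr_pdivrMr // in h2.
by apply/andP; split; lra.
Qed.

End Fround.

(** * Summation errors and the Chinese remainder weights *)

Section FlSum.
Variables (R : realType) (b : format) (I : Type).
Implicit Types (T : sum_tree I) (F x : I -> R) (z : I -> int).
Local Notation u := (unit_roundoff b : R).

Lemma unit_roundoff_gt0 : 0 < u.
Proof. by rewrite /unit_roundoff invr_gt0 exprn_gt0. Qed.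

Lemma size_leaves_gt0 T : (0 < size (leaves T))%N.
Proof. by elim: T => //= T1 h1 T2 h2; rewrite size_cat addn_gt0 h1. Qed.

(** One more rounding multiplies [(1 + u) ^+ d] by [1 + u]. The error is measured against a bound
    [S] of [|X|], not against [|X|], because sums may cancel. *)
Lemma fl_err_comp d (y X S : R) : `|X| <= S ->
  `|y - X| <= ((1 + u) ^+ d - 1) * S ->
  `|fl b y - X| <= ((1 + u) ^+ d.+1 - 1) * S.
Proof.
move=> hX hy; have u0 := unit_roundoff_gt0; have hfl := fl_err b y.
have h1 : `|y| <= (1 + u) ^+ d * S.
  rewrite -[y](subrK X); apply: le_trans (ler_normD _ _) _; lra.
have h2 := ler_distD y (fl b y) X; rewrite exprS.
have h3 : u * `|y| <= u * ((1 + u) ^+ d * S) by rewrite ler_wpM2l // ltW.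
lra.
Qed.

(** Each leaf already carries [d] roundings, and in a tree with [s] leaves it lies under at most
    [s - 1] additions, whatever the order of evaluation. *)
Lemma fl_sum_err T F x d :
  (forall i, `|F i - x i| <= ((1 + u) ^+ d - 1) * `|x i|) ->
  `|fl_sum b T F - \sum_(i <- leaves T) x i| <=
    ((1 + u) ^+ (d + (size (leaves T)).-1) - 1) * \sum_(i <- leaves T) `|x i|.
Proof.
move=> hF; have u0 := unit_roundoff_gt0.
elim: T => [i|T1 IH1 T2 IH2] /=.
  by rewrite !big_seq1 addn0.
rewrite size_cat !big_cat /=.
have s1 := size_leaves_gt0 T1; have s2 := size_leaves_gt0 T2.
set e := (d + (size (leaves T1) + size (leaves T2)).-2)%N.
have -> : (d + (size (leaves T1) + size (leaves T2)).-1)%N = e.+1.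
  by rewrite /e; lia.
have mono k y S : (k <= e)%N -> 0 <= S ->
    `|y| <= ((1 + u) ^+ k - 1) * S -> `|y| <= ((1 + u) ^+ e - 1) * S.
  move=> ke S0 h; apply: le_trans h _; rewrite ler_wpM2r // lerD2r.
  by rewrite ler_weXn2l // lerDl ltW.
apply: fl_err_comp.
  by apply: le_trans (ler_normD _ _) _; rewrite lerD // ler_norm_sum.
rewrite opprD addrACA mulrDr; apply: le_trans (ler_normD _ _) _.
by rewrite lerD //; [apply: mono IH1|apply: mono IH2];
   rewrite ?sumr_ge0 // /e; lia.
Qed.

(** All partial sums are integer multiples of the same [2 ^ e], with significands bounded by the sum
    of the [|z i|]; hence no addition rounds. *)
Lemma fl_sum_exact T z e : \sum_(i <- leaves T) `|z i| <= 2 ^+ prec b ->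
  fl_sum b T (fun i => (z i)%:~R * 2 ^ e) =
    (\sum_(i <- leaves T) z i)%:~R * 2 ^ e :> R.
Proof.
elim: T => [i|T1 IH1 T2 IH2] /=; first by rewrite !big_seq1.
rewrite !big_cat /= => h.
have h1 : 0 <= \sum_(i <- leaves T1) `|z i| by rewrite sumr_ge0.
have h2 : 0 <= \sum_(i <- leaves T2) `|z i| by rewrite sumr_ge0.
have {}IH1 := IH1 (le_trans _ h); have {}IH2 := IH2 (le_trans _ h).
rewrite IH1 ?IH2 ?lerDl ?lerDr //.
rewrite -mulrDl -intrD fl_fp //; apply: is_fp_pow2 (erefl _) => //.
  apply: le_trans h; apply: le_trans (ler_normD _ _) _.
  by rewrite lerD // ler_norm_sum.
exact: prec_gt0.
Qed.

End FlSum.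

Lemma expr1D_le (R : realType) (u : R) n : 0 <= u -> n%:R * u <= 1 ->
  (1 + u) ^+ n - 1 <= n%:R * u + n%:R ^+ 2 * u ^+ 2.
Proof.
move=> u0; elim: n => [|n IH] h; first by rewrite expr0 subrr expr0n !mul0r addr0.
have n0 : 0 <= n%:R :> R by [].
rewrite -natr1 in h *.
have {}IH := IH ltac:(by rewrite mulrDl in h; lra).
rewrite exprSr; have : ((1 + u) ^+ n - 1) * (1 + u) <=
  (n%:R * u + n%:R ^+ 2 * u ^+ 2) * (1 + u) by rewrite ler_wpM2r //; lra.
set X := (1 + u) ^+ n; move: (n%:R : R) n0 h IH => t n0 h IH h2.
(* The only cubic term of the expansion; [n u <= 1] makes it quadratic. *)
have h3 : t * u * (t * u ^+ 2) <= 1 * (t * u ^+ 2).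
  by rewrite ler_wpM2r ?mulr_ge0 ?sqr_ge0 //; lra.
have h4 : 0 <= t * u ^+ 2 by rewrite mulr_ge0 ?sqr_ge0.
have h5 : 0 <= u ^+ 2 by rewrite sqr_ge0.
lra.
Qed.

(** * The moduli and their Chinese remainder weights *)

Section Moduli.

(** The modulus 256 is set apart because only there can wrap-around change a stored value; below it
    [floor (p / 2) <= 127]. *)
Lemma moduliP l : (l < 49)%N ->
  (28 < modulus l)%N && ((modulus l < 256)%N || (modulus l == 256)%N).
Proof.
move=> hl; have : all (fun p => (28 < p) && ((p < 256) || (p == 256)))%N moduli.
  by vm_compute.
by move/all_nthP => /(_ 0%N l hl).
Qed.

Lemma modulus_gt l : (l < 49)%N -> (28 < modulus l)%N.
Proof. by move/moduliP/andP => []. Qed.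

Lemma modulus_le l : (l < 49)%N -> (modulus l <= 256)%N.
Proof. by move/moduliP; lia. Qed.

Lemma coprime_modulus l h : (l < 49)%N -> (h < 49)%N -> l != h ->
  coprime (modulus l) (modulus h).
Proof.
wlog lh : l h / (l < h)%N.
  move=> W hl hh nlh; have [lh|hl'] := ltnP l h; first exact: W.
  by rewrite coprime_sym W // 1?eq_sym // ltn_neqAle eq_sym nlh.
move=> hl hh _; have : pairwise coprime moduli by vm_compute.
by move/(pairwiseP 0%N) => /(_ l h); rewrite !inE; apply.
Qed.

Variable N : nat.
Hypothesis hN : (N <= 49)%N.
Implicit Types l h : 'I_N.

Let lt49 l : (l < 49)%N. Proof. exact: leq_trans (ltn_ord l) hN. Qed.

Lemma modulus_gt0 l : (0 < modulus l)%N.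
Proof. exact: leq_trans (modulus_gt (lt49 l)). Qed.

Lemma Pprod_gt0 : (0 < Pprod N)%N.
Proof. by rewrite prodn_gt0 // => l; exact: modulus_gt0. Qed.

Lemma PprodD1 l : Pprod N = (modulus l * \prod_(h < N | h != l) modulus h)%N.
Proof. by rewrite /Pprod (bigD1 l). Qed.

Lemma Pprod_divE l : (Pprod N %/ modulus l)%N = \prod_(h < N | h != l) modulus h.
Proof. by rewrite (PprodD1 l) mulKn ?modulus_gt0. Qed.

Lemma qinvP l :
  (qinv l < modulus l)%N /\ (crt_weight l = 1 %[mod modulus l])%N.
Proof.
have p0 := modulus_gt0 l.
have p1 : (1 < modulus l)%N by have := modulus_gt (lt49 l); lia.
set D := (Pprod N %/ modulus l)%N.
have D0 : (0 < D)%N by rewrite /D Pprod_divE prodn_gt0 // => h; exact: modulus_gt0.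
have cop : coprime D (modulus l).
  rewrite /D Pprod_divE coprime_sym.
  apply: (big_rec (coprime (modulus l))) => [|h x hl cx].
    exact: coprimen1.
  by rewrite coprimeMr cx andbT coprime_modulus ?lt49 // eq_sym.
set a := fun q => (D * q == 1 %[mod modulus l])%N.
(* A Bezout coefficient, reduced modulo [p_l], is a witness, so that [find] in [qinv] stops inside
   the list. *)
have hs : has a (iota 0 (modulus l)).
  case: (egcdnP (modulus l) D0) => q r; rewrite (eqP cop) => hq _.
  apply/hasP; exists (q %% modulus l)%N; first by rewrite mem_iota /= ltn_pmod.
  by rewrite /a modnMmr mulnC hq modnMDl.
split; first by have := hs; rewrite has_find size_iota.
have := nth_find 0%N hs; rewrite nth_iota; last first.
  by have := hs; rewrite has_find size_iota.
by rewrite add0n => /eqP.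
Qed.

Lemma crt_weight_dvd l h : h != l -> (modulus h %| crt_weight l)%N.
Proof.
move=> hl; rewrite /crt_weight Pprod_divE dvdn_mulr //.
by rewrite (bigD1 h) //= dvdn_mulr.
Qed.

(* As [qinv l < modulus l], a weight stays below [P (1 - 1 / p_l)]. *)
Lemma crt_weight_le l :
  (modulus l * crt_weight l + Pprod N <= modulus l * Pprod N)%N.
Proof.
have [hq _] := qinvP l; rewrite /crt_weight Pprod_divE (PprodD1 l).
set D := (\prod_(h < N | _) _)%N; rewrite -mulnDr -[X in (_ + X)%N]muln1.
by rewrite -mulnDr addn1 [(modulus l * D)%N]mulnC !leq_mul.
Qed.

Lemma crt_weight_gt0 l : (0 < crt_weight l)%N.
Proof.
have [_] := qinvP l; case: (crt_weight l) => // /eqP.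
by rewrite mod0n modn_small // (leq_trans _ (modulus_gt (lt49 l))).
Qed.

(** Modulo [p_l] every term but the [l]-th vanishes and the [l]-th weight is 1. Pairwise coprimality
    combines the congruences into one modulo [P]. *)
Lemma crt_congr (M : int) (w : 'I_N -> int) :
  (forall l, ((modulus l)%:Z %| w l - M)%Z) ->
  exists q : int, \sum_(l < N) (crt_weight l)%:Z * w l = M + (Pprod N)%:Z * q.
Proof.
move=> hw; set S := \sum_(l < N) _.
suff : ((Pprod N)%:Z %| S - M)%Z.
  by case/dvdzP => q hq; exists q; rewrite mulrC -hq addrC subrK.
rewrite dvdzE /= /Pprod.
apply/(Gauss_dvd_prod (r := index_enum 'I_N) (P := predT)
  (F := fun l : 'I_N => modulus l)).
  rewrite filter_predT pairwise_map.
  have : pairwise [rel l h : 'I_N | l != h] (index_enum 'I_N).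
    by rewrite -uniq_pairwise index_enum_uniq.
  by apply: sub_pairwise => l h /= lh; apply: coprime_modulus.
move=> l _ _; rewrite -[modulus l]/`|(modulus l)%:Z|%N -dvdzE.
rewrite /S (bigD1 l) //= addrAC rpredD //; last first.
  apply: rpred_sum => h hl; apply: dvdz_mulr.
  by rewrite dvdzE crt_weight_dvd // eq_sym.
have -> : (crt_weight l)%:Z * w l - M
  = ((crt_weight l)%:Z - 1) * w l + (w l - M) by ring.
rewrite rpredD //; apply: dvdz_mulr.
have [_ h1] := qinvP l; rewrite -eqz_mod_dvd; apply/eqP.
by rewrite -[1]/(1%:Z) !modz_nat h1.
Qed.

End Moduli.

(** * Size of the product of the moduli *)

Lemma prod_take_moduli N : (N <= 49)%N ->
  (\prod_(p <- take N moduli) p)%N = Pprod N.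
Proof.
move=> hN; rewrite (big_nth 0%N) size_takel // /Pprod big_mkord.
by apply: eq_bigr => l _; rewrite nth_take.
Qed.

Section BinaryGap.
Notation Nmul := BinNat.N.mul.
Notation Npow2 := (BinNat.N.pow (bin_of_nat 2)).

Definition binprod (s : seq nat) : BinNums.N :=
  foldr (fun p => Nmul (bin_of_nat p)) (bin_of_nat 1) s.

Lemma binprodE s : nat_of_bin (binprod s) = (\prod_(p <- s) p)%N.
Proof.
elim: s => [|p s IH]; first by rewrite big_nil.
rewrite big_cons -IH /= -[in RHS](bin_of_natK p); lia.
Qed.

(* For [2 ^ L <= x < 2 ^ (L + 1)], the excess [x - 2 ^ L] is at least
   [2 ^ (L - 20)]; computed in binary because [x] has up to 342 bits. *)
Definition binary_gap (x : BinNums.N) : bool :=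
  let y := Npow2 (BinNat.N.log2 x) in
  let k := Npow2 (bin_of_nat 20) in
  BinNat.N.leb (BinNat.N.add (Nmul y k) y) (Nmul k x)
  && BinNat.N.ltb x (Nmul (bin_of_nat 2) y).

(** The range is [N = 2, ..., 49]; the predecessor appears because the scaling compares powers of
    two with [P - 1]. *)
Lemma moduli_binary_gap :
  all (fun n => binary_gap (BinNat.N.pred (binprod (take n moduli))))
    (iota 2 48).
Proof. by vm_compute. Qed.

Lemma nat_of_bin_pow2 n : nat_of_bin (Npow2 n) = (2 ^ nat_of_bin n)%N.
Proof.
elim/BinNat.N.peano_ind: n => // n IH; rewrite BinNat.N.pow_succ_r'.
have -> : nat_of_bin (BinNat.N.succ n) = (nat_of_bin n).+1 by lia.
rewrite expnS -IH; lia.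
Qed.

Lemma Pprod_binary_gap N : (2 <= N <= 49)%N ->
  exists L, (2 ^ L * 2 ^ 20 + 2 ^ L <= 2 ^ 20 * (Pprod N).-1)%N /\
    ((Pprod N).-1 < 2 ^ L.+1)%N.
Proof.
move=> /andP[h2 h49]; have := allP moduli_binary_gap N.
rewrite mem_iota h2 /= ltnS h49 => /(_ isT).
set x := binprod _; have xE : nat_of_bin x = Pprod N.
  by rewrite binprodE prod_take_moduli.
rewrite /binary_gap => /andP[]; exists (nat_of_bin (BinNat.N.log2 (BinNat.N.pred x))).
have -> : expn 2 20 = nat_of_bin (Npow2 (bin_of_nat 20)).
  by rewrite nat_of_bin_pow2 bin_of_natK.
rewrite -xE expnS -nat_of_bin_pow2.
move: (Npow2 (bin_of_nat 20)) (Npow2 _) a b => k y a b; split; lia.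
Qed.

End BinaryGap.

(** The first two moduli contribute [128 + 127]. *)
Lemma rho_ge N : (2 <= N)%N -> (255 <= rho N)%N.
Proof. by case: N => [|[|N]] // _; rewrite /rho !big_ord_recl addnA leq_addr. Qed.

Lemma rho_le N : (N <= 49)%N -> (rho N <= 4096)%N.
Proof.
move=> hN; apply: (@leq_trans (rho 49)); last first.
  by rewrite /rho !big_ord_recr big_ord0; vm_compute.
rewrite /rho (big_ord_widen 49 (fun l => modulus l %/ 2)%N hN).
by rewrite big_mkcond leq_sum // => l _; case: ifP.
Qed.

Lemma Pprod_gt2 N : (2 <= N <= 49)%N -> (2 < Pprod N)%N.
Proof.
case: N => [|[|N]] // hN; rewrite /Pprod !big_ord_recl mulnA.
apply: (@leq_trans (256 * 255)) => //; rewrite leq_pmulr //.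
apply: prodn_gt0 => l; rewrite (ltn_trans _ (modulus_gt _)) // !lift0.
by have := ltn_ord l; lia.
Qed.

Lemma Pprod_le N : (N <= 49)%N -> (Pprod N <= 2 ^ 392)%N.
Proof.
move=> hN; apply: (@leq_trans (256 ^ N)).
  rewrite -[X in (_ <= _ ^ X)%N]card_ord -prod_nat_const leq_prod // => l _.
  by rewrite modulus_le // (leq_trans (ltn_ord l)).
by rewrite -[256%N]/(2 ^ 8)%N -expnM leq_exp2l //; lia.
Qed.

(** * Residues *)

Lemma ler_sum_ord (R : numDomainType) k (F : 'I_k -> R) c :
  (forall h, F h <= c) -> \sum_h F h <= k%:R * c.
Proof.
move=> hF; apply: le_trans (ler_sum _ (fun h _ => hF h)) _.
by rewrite sumr_const card_ord mulr_natl.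
Qed.

Section IntWrap.
Implicit Types (z : int) (w : nat).

Lemma int_wrap_dvd w z : ((2 ^+ w : int) %| int_wrap w z - z)%Z.
Proof.
rewrite /int_wrap; have := divz_eq (z + 2 ^+ w.-1) (2 ^+ w).
set q := (_ %/ _)%Z => e; apply/dvdzP; exists (- q).
set r := (_ %% _)%Z in e *; lia.
Qed.

Lemma int_wrap_range w z : (0 < w)%N ->
  - 2 ^+ w.-1 <= int_wrap w z < 2 ^+ w.-1.
Proof.
case: w => // w _; rewrite /int_wrap /=.
have h : 0 < (2 : int) ^+ w.+1 by rewrite exprn_gt0.
have := modz_ge0 (z + 2 ^+ w) (lt0r_neq0 h).
have := ltz_pmod (z + 2 ^+ w) h.
rewrite exprS; move: ((z + 2 ^+ w) %% _)%Z => r; lia.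
Qed.

Lemma int_wrap_id w z : (0 < w)%N -> - 2 ^+ w.-1 <= z < 2 ^+ w.-1 ->
  int_wrap w z = z.
Proof.
case: w => // w _ /= hz; rewrite /int_wrap /= modz_small ?addrK //.
by rewrite exprS; lia.
Qed.

Lemma int_wrap0 w : (0 < w)%N -> int_wrap w 0 = 0.
Proof.
move=> w0; rewrite int_wrap_id // oppr_le0 exprn_ge0 //=.
by rewrite exprn_gt0.
Qed.

End IntWrap.

Section Residues.
Variables (R : realType) (rint : R -> int) (hrint : nearest_int rint).
Implicit Types (z q : int) (x : R).

Lemma rint_near x q : `|x - q%:~R| < 1 / 2 -> rint x = q.
Proof.
move=> h; have h1 := hrint x; apply/eqP; rewrite -subr_eq0 -absz_eq0.
have : `|(rint x - q)%:~R| < 1 :> R.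
  have := ler_distD x (rint x)%:~R q%:~R; rewrite intrB (distrC _ x).
  lra.
by rewrite -intr_norm -[1]/(1%:~R) ltr_int; lia.
Qed.

Lemma cmod_dvd z p : (p%:Z %| cmod rint z p - z)%Z.
Proof.
by rewrite /cmod addrAC subrr add0r -mulrN dvdz_mulr.
Qed.

Lemma cmod_le z p : (0 < p)%N -> 2 * `|cmod rint z p| <= p%:Z.
Proof.
move=> p0; have p0' : 0 < p%:R :> R by rewrite ltr0n.
have := hrint (z%:~R / p%:R); rewrite -(ler_pM2r p0') -[X in _ * X <= _](gtr0_norm p0').
rewrite -normrM mulrBl divfK ?gt_eqF // => h.
rewrite -(ler_int R) intrM intr_norm /cmod intrB intrM -[p%:~R]/(p%:R).
by rewrite [p%:R * _]mulrC; lra.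
Qed.

Lemma cmod0 p : cmod rint 0 p = 0.
Proof.
by rewrite /cmod mul0r (@rint_near _ 0) ?mulr0 ?subrr // normr0; lra.
Qed.

Definition residue z l := int_wrap 8 (cmod rint z (modulus l)).

(** For [p_l < 256] the symmetric residue fits in 8 bits. For [p_l = 256] the wrap-around subtracts
    a multiple of the modulus and keeps the range [[-128, 127]]. *)
Lemma residueP z l : (l < 49)%N ->
  ((modulus l)%:Z %| residue z l - z)%Z /\ `|residue z l| <= (modulus l %/ 2)%:Z.
Proof.
move=> hl; have := moduliP hl; have := @cmod_dvd z (modulus l).
have := @cmod_le z (modulus l); rewrite /residue.
have := @int_wrap_dvd 8 (cmod rint z (modulus l)).
have := @int_wrap_range 8 (cmod rint z (modulus l)) isT.
have := @int_wrap_id 8 (cmod rint z (modulus l)) isT.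
move: (cmod _ _ _) => y hid hrg h8 + hy /andP[p28 /orP[p256|/eqP p256]].
  move=> /(_ (ltnW (leq_trans _ p28)))-/(_ isT) hle.
  have yE : int_wrap 8 y = y by apply: hid; rewrite /=; lia.
  by rewrite yE; split => //; lia.
move=> _; split; last by move: hrg; rewrite p256 /=; lia.
rewrite -(subrKA y) rpredD //.
by rewrite p256.
Qed.

Section Product.
Variables (N m k n : nat) (hN : (N <= 49)%N) (hk : (k <= 2 ^ 17)%N).
Variables (A' : 'M[int]_(m, k)) (B' : 'M[int]_(k, n)).

Let lt49 (l : 'I_N) : (l < 49)%N. Proof. exact: leq_trans (ltn_ord l) hN. Qed.

Lemma Cmod_dvd (l : 'I_N) i j :
  ((modulus l)%:Z %| Cmod rint A' B' l i j - (A' *m B') i j)%Z.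
Proof.
rewrite mxE; set c := (Amod _ _ l *m _) i j.
have hc : ((modulus l)%:Z %| c - (A' *m B') i j)%Z.
  rewrite /c !mxE -sumrB rpred_sum // => h _; rewrite !mxE.
  have [ha _] := residueP (A' i h) (lt49 l).
  have [hb _] := residueP (B' h j) (lt49 l).
  rewrite -[X in X - _]/(residue _ _ * residue _ _).
  move: (residue _ _) (residue _ _) ha hb => b a ha hb.
  have -> : a * b - A' i h * B' h j
    = (a - A' i h) * b + A' i h * (b - B' h j) by ring.
  by apply: rpredD; [exact: dvdz_mulr|exact: dvdz_mull].
have cle : `|c| <= k%:Z * ((modulus l %/ 2 * (modulus l %/ 2))%N%:Z).
  rewrite /c mxE; apply: le_trans (ler_norm_sum _ _ _) _.
  rewrite -natz ler_sum_ord // => h; rewrite !mxE normrM PoszM ler_pM //.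
    by have [] := residueP (A' i h) (lt49 l).
  by have [] := residueP (B' h j) (lt49 l).
(* For [p_l < 256] no overflow occurs, as [2 ^ 17 * 127 ^ 2 < 2 ^ 31]. For [p_l = 256] the
   wrap-around is by a multiple of [2 ^ 32], hence of 256. *)
have := moduliP (lt49 l) => /andP[p28 /orP[p256|/eqP p256]].
  rewrite int_wrap_id //.
  have hq : (modulus l %/ 2 <= 127)%N by lia.
  have : (k * (modulus l %/ 2 * (modulus l %/ 2)) <= 2 ^ 17 * (127 * 127))%N.
    by rewrite !leq_mul.
  move: (modulus l %/ 2 * (modulus l %/ 2))%N cle => q; rewrite /=; lia.
rewrite -(subrKA c) rpredD // p256.
have h : ((2 ^+ 8 : int) %| 2 ^+ 8 * 2 ^+ 24)%Z by exact: dvdz_mulr.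
rewrite -exprD in h.
exact: (dvdz_trans h (int_wrap_dvd 32 c)).
Qed.

Lemma W_dvd (l : 'I_N) i j :
  ((modulus l)%:Z %| W rint A' B' l i j - (A' *m B') i j)%Z.
Proof.
rewrite mxE -(subrKA (Cmod rint A' B' l i j)) rpredD ?Cmod_dvd //.
by have [] := residueP (Cmod rint A' B' l i j) (lt49 l).
Qed.

Lemma W_le (l : 'I_N) i j :
  `|W rint A' B' l i j| <= (modulus l %/ 2)%:Z.
Proof.
by rewrite mxE; have [] := residueP (Cmod rint A' B' l i j) (lt49 l).
Qed.

(** Each product must vanish, not only their sum, for the products of residues to vanish too. This
    serves the entries where [Cbar] is 0. *)
Lemma W_eq0 (l : 'I_N) i j : (forall h, A' i h * B' h j = 0) ->
  W rint A' B' l i j = 0.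
Proof.
move=> AB0; rewrite mxE.
have -> : Cmod rint A' B' l i j = 0; last by rewrite cmod0 int_wrap0.
rewrite mxE; set c := (_ *m _) i j.
have -> : c = 0; last exact: int_wrap0.
rewrite /c mxE big1 // => h _; rewrite !mxE.
have /eqP := AB0 h; rewrite mulf_eq0.
by case/orP => /eqP ->; rewrite cmod0 int_wrap0 // ?mul0r ?mulr0.
Qed.

End Product.

End Residues.

(** * Rounding errors of the reconstruction *)

Section Arithmetic.
Variables (R : realFieldType) (n rho u P d : R).
Hypotheses (hn : 2 <= n <= 49) (hrho : 255 <= rho <= 2 ^+ 12).
Hypotheses (hd : d = 2 ^- 28) (hu : u = 2 ^- 53).
Hypothesis (hP : 0 < P).
(** [sigma * P] will bound the sum of the [|w_l W_l|]; the saving [n / 3] over [rho] pays for the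
    roundings outside the stated coefficients. *)
Local Notation sigma := (rho - n / 3).

Lemma unit_roundoff_pos : 0 < u.
Proof. by rewrite hu invr_gt0 exprn_gt0. Qed.

Lemma sum_err_arith :
  ((n + 1) * u + (n + 1) ^+ 2 * u ^+ 2) * (sigma * P)
    <= u * P * ((n + 1) * sigma + 1 / 2).
Proof.
have u0 := unit_roundoff_pos; have P0 := hP; have /andP[n2 n49] := hn.
have /andP[r1 r2] := hrho.
have h1 : (n + 1) ^+ 2 <= 50 ^+ 2 by rewrite lerXn2r ?nnegrE; lra.
have h2 : (n + 1) ^+ 2 * sigma <= 50 ^+ 2 * 2 ^+ 12 by rewrite ler_pM ?sqr_ge0 //; lra.
have h3 : u * ((n + 1) ^+ 2 * sigma) <= u * (50 ^+ 2 * 2 ^+ 12).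
  by rewrite ler_wpM2l // ltW.
have h4 : u * P * (u * ((n + 1) ^+ 2 * sigma)) <= u * P * (1 / 2).
  rewrite ler_wpM2l ?mulr_ge0 ?ltW //; move: h3; rewrite hu; lra.
lra.
Qed.

Lemma sum_err_small : u * P * ((n + 1) * sigma + 1 / 2) <= d * P.
Proof.
have P0 := hP; have /andP[n2 n49] := hn; have /andP[r1 r2] := hrho.
have u0 := unit_roundoff_pos.
rewrite mulrAC ler_wpM2r ?ltW //.
have h1 : (n + 1) * sigma <= 50 * 2 ^+ 12 by rewrite ler_pM //; lra.
have h2 : u * ((n + 1) * sigma + 1 / 2) <= u * (50 * 2 ^+ 12 + 1 / 2).
  by rewrite ler_wpM2l ?lerD2r // ltW.
by move: h2; rewrite hu hd; lra.
Qed.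

(** [x] is the exact argument of the [fma] and [y] its rounding, which costs at most [u P]. Since
    [n (n + 2) / 3 >= 8 / 3 > 2], passing from [sigma] to [rho] pays for this and for the [+ 1]. *)
Lemma crt32_arith (M x y : R) : `|M| <= P / 2 ->
  `|x - M| <= u * P * ((n + 2) * sigma + 1) -> `|y - x| <= u * `|x| ->
  `|y - M| <= (n + 2) * u * rho * P.
Proof.
move=> hM hx hy.
have P0 := hP; have /andP[n2 n49] := hn; have /andP[r1 r2] := hrho.
have u0 := unit_roundoff_pos; have uP0 : 0 <= u * P by rewrite mulr_ge0 // ltW.
have h1 : (n + 2) * sigma <= (n + 2) * rho - 8 / 3 by nra.
have h2 : (n + 2) * rho <= 51 * 2 ^+ 12 by rewrite ler_pM //; lra.
have h3 : `|x - M| <= P / 2.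
  apply: le_trans hx _; rewrite mulrAC [leRHS]mulrC ler_wpM2r ?ltW //.
  have : u * ((n + 2) * sigma + 1) <= u * (51 * 2 ^+ 12).
    by rewrite ler_wpM2l ?ltW //; lra.
  by rewrite hu; lra.
have h4 : `|x| <= P by have := ler_normD (x - M) M; rewrite subrK; lra.
have h5 : u * `|x| <= u * P by rewrite ler_wpM2l // ltW.
have h6 := ler_distD x y M.
have : u * P * ((n + 2) * sigma + 2) <= u * P * ((n + 2) * rho).
  by rewrite ler_wpM2l //; lra.
lra.
Qed.

(** [c / P - Q] is [M / P] plus an error of at most [d], so at most [1 / 2 - d] in absolute value.
    The roundings of [1 / P] and of the product add at most [u (2 ^ 13 + 2 ^ 14)], which is below
    [d]. *)
Lemma quotient_arith (Q M c y z : R) : `|M| <= P / 2 - 2 * d * P ->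
  `|Q| <= sigma + 1 / 2 -> `|c - (M + P * Q)| <= d * P ->
  `|y - c / P| <= u * `|c / P| -> `|z - y| <= u * `|y| ->
  `|z - Q| < 1 / 2.
Proof.
move=> hM hQ hc hy hz; have P0 := hP; have /andP[n2 n49] := hn.
have /andP[r1 r2] := hrho; have u0 := unit_roundoff_pos.
have hcP : `|c / P - Q| <= 1 / 2 - d.
  rewrite -(ler_pM2r P0) -[X in _ * X <= _](gtr0_norm P0) -normrM mulrBl.
  rewrite divfK ?gt_eqF //.
  have -> : c - Q * P = (c - (M + P * Q)) + M by ring.
  have := ler_normD (c - (M + P * Q)) M; lra.
have hcP' : `|c / P| <= 2 ^+ 13.
  have := ler_normD (c / P - Q) Q; rewrite subrK; rewrite hd in hcP.
  by lra.
have h1 : u * `|c / P| <= u * 2 ^+ 13 by rewrite ler_wpM2l // ltW.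
have h2 : `|y| <= 2 ^+ 14.
  have := ler_normD (y - c / P) (c / P); rewrite subrK.
  by move: hy h1; rewrite hu; lra.
have h3 : u * `|y| <= u * 2 ^+ 14 by rewrite ler_wpM2l // ltW.
have h4 := ler_distD y z Q.
have h5 := ler_distD (c / P) y Q.
have hu' := hu; have hd' := hd.
lra.
Qed.

(* The constant [kappa] stands for [2 ^ (1 + ceil (log2 rho))]. *)
Lemma truncation_arith kappa : 2 * rho <= kappa <= 2 ^+ 13 ->
  kappa * u * rho * P <= d * P.
Proof.
move=> /andP[k1 k2]; have /andP[r1 r2] := hrho; have u0 := unit_roundoff_pos.
have P0 := hP; rewrite ler_wpM2r ?(ltW P0) //.
have h : kappa * rho <= 2 ^+ 13 * 2 ^+ 12 by rewrite ler_pM //; lra.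
have : u * (kappa * rho) <= u * (2 ^+ 13 * 2 ^+ 12) by rewrite ler_wpM2l ?(ltW u0).
by rewrite hd mulrC mulrA mulrAC hu; lra.
Qed.

Lemma roundoff_arith :
  (n + 1) * u + (n + 1) ^+ 2 * u ^+ 2 <= (n + 1) * u * (1 + 1 / 2 ^+ 10).
Proof.
have u0 := unit_roundoff_pos; have /andP[n2 n49] := hn.
have h : (n + 1) * u <= 1 / 2 ^+ 10 by rewrite hu; lra.
rewrite -exprMn mulrDr mulr1 lerD2l expr2 ler_wpM2l // mulr_ge0 ?(ltW u0) //.
lra.
Qed.

Lemma truncation_arith_weak kappa : 2 * rho <= kappa <= 2 ^+ 13 ->
  kappa * u * rho * P * (1 - 1 / 256) <= d * P.
Proof.
move=> hk; apply: le_trans (truncation_arith hk).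
have /andP[r1 r2] := hrho; have /andP[k1 k2] := hk.
have u0 := unit_roundoff_pos; have P0 := hP.
have h : 0 <= kappa * u * rho * P by rewrite !mulr_ge0 ?(ltW u0) ?(ltW P0) //; lra.
by lra.
Qed.

(* The exact values [M - r + a], [r] and [a + p] stand for [C1 - Q P1], the sum
   approximated by [C2], and [Q P2]; [x1], [x2], [x3] are the three roundings.
   The gap [K / 256] between [G] and [K] absorbs the second-order terms. *)
Lemma crt64_arith (kappa M r a c2 p x1 x2 x3 G K: R) :
  2 * rho <= kappa <= 2 ^+ 13 -> `|M| <= P / 2 ->
  K = kappa * u * rho * P -> `|r| <= G -> G <= K * (1 - 1 / 256) ->
  `|a| <= rho * (u * P) -> `|p| <= rho * (u * (u * P)) ->
  `|c2 - r| <= (n + 1) * u * (1 + 1 / 2 ^+ 10) * G ->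
  `|x1 - (M - r + a)| <= u * `|M - r + a| ->
  `|x2 - (x1 + c2)| <= u * `|x1 + c2| ->
  `|x3 - (x2 - (a + p))| <= u * `|x2 - (a + p)| ->
  `|x3 - M| <= (n + 2) * u * K + 3 * u * `|M|.
Proof.
move=> hk hM hK hr hG ha hp hc h1 h2 h3.
have KP := truncation_arith hk; rewrite -hK hd in KP.
move: hk => /andP[k1 k2].
have P0 := hP; have /andP[n2 n49] := hn; have /andP[r1 r2] := hrho.
have u0 := unit_roundoff_pos; have u0' := ltW u0.
(* Units for the first-order and second-order quantities, so that the estimates below become
   linear. *)
pose v := u * P; pose e := u * v.
have v0 : 0 <= v by rewrite mulr_ge0 // ltW.
have e0 : 0 <= e by rewrite mulr_ge0.
have vP : v <= P / 2 ^+ 24 by rewrite /v hu; lra.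
have K0 : 0 <= K by rewrite hK !mulr_ge0 // ?ltW //; lra.
have G0 : 0 <= G := le_trans (normr_ge0 _) hr.
have GP : G <= P / 2 ^+ 20 by lra.
rewrite -/v in ha; rewrite -/v -/e in hp.
have rP : rho * v <= P / 2 ^+ 12.
  apply: le_trans (_ : 2 ^+ 12 * v <= _); last by lra.
  by rewrite ler_wpM2r.
have re : rho * e <= v.
  have -> : rho * e = u * (rho * v) by rewrite /e mulrCA.
  by rewrite ler_wpM2l //; lra.
have uG : u * G <= v by rewrite ler_wpM2l //; lra.
have cG : (n + 1) * u * (1 + 1 / 2 ^+ 10) * G <= v.
  have h : (n + 1) * G <= 50 * (P / 2 ^+ 20) by rewrite ler_pM //; lra.
  have -> : (n + 1) * u * (1 + 1 / 2 ^+ 10) * G =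
    u * ((n + 1) * G * (1 + 1 / 2 ^+ 10)) by ring.
  by rewrite ler_wpM2l //; lra.
have mulu (y z : R) : y <= z -> u * y <= u * z by move=> ?; rewrite ler_wpM2l.
have t1 : `|M - r + a| <= `|M| + G + rho * v.
  by have := ler_normD (M - r) a; have := ler_normB M r; lra.
have hE1 : u * `|M - r + a| <= u * `|M| + u * G + rho * e.
  by have := mulu _ _ t1; rewrite !mulrDr (mulrCA u rho).
have hE1' : `|x1 - (M - r + a)| <= v.
  by apply: le_trans h1 _; apply: mulu; lra.
have t2 : `|x1 + c2| <= `|M| + rho * v + 2 * v.
  have -> : x1 + c2 = (M + a) + ((x1 - (M - r + a)) + (c2 - r)) by ring.
  have := ler_normD (M + a) ((x1 - (M - r + a)) + (c2 - r)).
  have := ler_normD M a; have := ler_normD (x1 - (M - r + a)) (c2 - r); lra.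
have hE2 : u * `|x1 + c2| <= u * `|M| + rho * e + 2 * e.
  by have := mulu _ _ t2; rewrite !mulrDr (mulrCA u rho) (mulrCA u 2).
have hE2' : `|x2 - (x1 + c2)| <= v.
  by apply: le_trans h2 _; apply: mulu; lra.
have t3 : `|x2 - (a + p)| <= `|M| + 4 * v.
  have -> : x2 - (a + p) =
    (M + (x2 - (x1 + c2))) + ((x1 - (M - r + a)) + (c2 - r)) - p by ring.
  have := ler_normB (M + (x2 - (x1 + c2)) + (x1 - (M - r + a) + (c2 - r))) p.
  have := ler_normD (M + (x2 - (x1 + c2))) ((x1 - (M - r + a)) + (c2 - r)).
  have := ler_normD M (x2 - (x1 + c2)).
  have := ler_normD (x1 - (M - r + a)) (c2 - r); lra.
have hE3 : u * `|x2 - (a + p)| <= u * `|M| + 4 * e.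
  by have := mulu _ _ t3; rewrite !mulrDr (mulrCA u 4).
(* [3 rho e + 6 e] collects the second-order parts of the three roundings and of [p]. As
   [kappa >= 510] and [rho >= 255], it fits together with the [2 ^ -10] term into the gap
   [(n + 2) u K / 256]. *)
have slack : (n + 1) * u * (1 + 1 / 2 ^+ 10) * G + u * G + 3 * (rho * e) + 6 * e
    <= (n + 2) * u * K.
  have s1 : 510 * (rho * e) <= u * K.
    have -> : u * K = kappa * (rho * e) by rewrite hK /e /v; ring.
    by rewrite ler_wpM2r ?mulr_ge0 //; lra.
  have s2 : (n + 2) * (u * G) <= (n + 2) * (u * K * (1 - 1 / 256)).
    by rewrite ler_wpM2l -?mulrA ?mulu //; lra.
  have s3 : 4 * (u * K) <= (n + 2) * (u * K).
    by rewrite ler_wpM2r ?mulr_ge0 //; lra.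
  have s4 : 255 * e <= rho * e by rewrite ler_wpM2r.
  have s5 : 0 <= u * G by rewrite mulr_ge0.
  by lra.
(* In the telescoping sum [a] cancels: subtracting [Q P2] undoes the error of [P1] and leaves only
   [p]. *)
have : `|x3 - M| <= `|x3 - (x2 - (a + p))| + `|x2 - (x1 + c2)|
    + `|x1 - (M - r + a)| + `|c2 - r| + `|p|.
  have {1}-> : x3 - M = (x3 - (x2 - (a + p))) + (x2 - (x1 + c2))
    + (x1 - (M - r + a)) + (c2 - r) - p by ring.
  apply: le_trans (ler_normB _ _) _; rewrite lerD2r.
  apply: le_trans (ler_normD _ _) _; rewrite lerD2r.
  apply: le_trans (ler_normD _ _) _; rewrite lerD2r.
  exact: ler_normD.
lra.
Qed.

End Arithmetic.

Lemma eq_fl_sum (R : realType) b I (T : sum_tree I) (F G : I -> R) :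
  F =1 G -> fl_sum b T F = fl_sum b T G.
Proof. by move=> FG; elim: T => [i|T1 IH1 T2 IH2] /=; rewrite ?FG ?IH1 ?IH2. Qed.

Lemma fl_sum0 (R : realType) b I (T : sum_tree I) :
  fl_sum b T (fun=> 0) = 0 :> R.
Proof. by elim: T => [i|T1 IH1 T2 IH2] //=; rewrite IH1 IH2 addr0 fl0. Qed.

Section SumOrder.
Variables (N : nat) (T : sum_tree 'I_N) (hT : sum_order T).

Lemma sum_leaves (V : nmodType) (F : 'I_N -> V) :
  \sum_(l <- leaves T) F l = \sum_l F l.
Proof. by rewrite (perm_big _ hT) big_enum. Qed.

Lemma size_leaves : size (leaves T) = N.
Proof. by rewrite (perm_size hT) size_enum_ord. Qed.

(** The exponent [N + 1] counts the rounding of the weight, that of the product, and [N - 1]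
    additions. *)
Lemma fl_sum_prod_err (R : realType) b (c : 'I_N -> R) (w : 'I_N -> int) :
  (0 < N)%N ->
  `|fl_sum b T (fun l => fl b (fl b (c l) * (w l)%:~R))
    - \sum_l c l * (w l)%:~R| <=
  ((1 + unit_roundoff b) ^+ N.+1 - 1) * \sum_l `|c l * (w l)%:~R|.
Proof.
move=> N0; rewrite -!sum_leaves.
have -> : N.+1 = (2 + (size (leaves T)).-1)%N by rewrite size_leaves; lia.
apply: fl_sum_err => l; apply: fl_err_comp => //.
rewrite expr1 addrAC subrr add0r -mulrBl !normrM mulrA.
by rewrite ler_wpM2r // fl_err.
Qed.

End SumOrder.

(** * Reconstruction of one entry from its residues *)

Section CRTError.
Variables (R : realType) (rint : R -> int) (hrint : nearest_int rint).
Variables (N : nat) (hN : (2 <= N <= 49)%N).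
Variables (T1 T2 : sum_tree 'I_N) (hT1 : sum_order T1) (hT2 : sum_order T2).
Variables (w : 'I_N -> int) (M q : int).
Hypothesis hw : forall l, `|w l| <= (modulus l %/ 2)%:Z.
Hypothesis hS : \sum_(l < N) (crt_weight l)%:Z * w l = M + (Pprod N)%:Z * q.

Let N49 : (N <= 49)%N. Proof. by case/andP: hN. Qed.
Let lt49 (l : 'I_N) : (l < 49)%N. Proof. exact: leq_trans (ltn_ord l) N49. Qed.

Local Notation P := (@GRing.natmul R 1 (Pprod N)).
Local Notation rho := (@GRing.natmul R 1 (rho N)).
Local Notation n := (@GRing.natmul R 1 N).
Local Notation cw l := (@GRing.natmul R 1 (crt_weight l)).
Local Notation u := (@unit_roundoff R FP64).
Local Notation sigma := (rho - n / 3).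

Local Notation d := (2 ^- 28 : R).
Hypothesis hM : `|M%:~R| <= P / 2 - 2 * d * P.

Let u64E : u = 2 ^- 53. Proof. by []. Qed.

Lemma P_gt0 : 0 < P.
Proof. by rewrite ltr0n Pprod_gt0. Qed.

Lemma rho_bounds : 255 <= rho <= 2 ^+ 12.
Proof.
by rewrite -natrX !ler_nat rho_le // rho_ge //; case/andP: hN.
Qed.

Lemma n_bounds : 2 <= n <= 49.
Proof. by rewrite !ler_nat. Qed.

Lemma crt_weight_natr (l : 'I_N) :
  (modulus l)%:R * cw l + P <= (modulus l)%:R * P.
Proof.
have := crt_weight_le N49 l; rewrite -(ler_nat R) natrD.
by rewrite (natrM _ _ (crt_weight l)) (natrM _ _ (Pprod N)).
Qed.

(** The margin [P / p_l] of [crt_weight_le] is smallest for [p_l = 256]. *)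
Lemma crt_weight_leR (l : 'I_N) : cw l <= P * (1 - 1 / 256).
Proof.
have h := crt_weight_natr l.
have h1 := modulus_le (lt49 l); rewrite -(ler_nat R) in h1.
have p0 : 0 < (modulus l)%:R :> R by rewrite ltr0n (modulus_gt0 N49).
have h2 : cw l <= P by rewrite -(ler_pM2l p0); have := P_gt0; lra.
have : (modulus l)%:R * (P - cw l) <= 256 * (P - cw l).
  by rewrite ler_wpM2r // subr_ge0.
lra.
Qed.

Lemma normw l : `|(w l)%:~R| <= (modulus l %/ 2)%:R :> R.
Proof. by rewrite -intr_norm -[leRHS]/((modulus l %/ 2)%N%:~R) ler_int. Qed.

(* [floor (p_l / 2) / p_l >= 1 / 3], so each term saves [P / 3] over
   [P * floor (p_l / 2)]. *)
Lemma sum_weight_le : \sum_l `|cw l * (w l)%:~R| <= sigma * P.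
Proof.
have -> : sigma * P = \sum_(l < N) ((modulus l %/ 2)%:R * P - P / 3).
  by rewrite sumrB -mulr_suml -natr_sum sumr_const card_ord -mulr_natl; ring.
apply: ler_sum => l _; rewrite normrM ger0_norm //.
apply: le_trans (ler_wpM2l _ (normw l)) _ => //.
have h := crt_weight_natr l.
have p0 : 0 < (modulus l)%:R :> R by rewrite ltr0n (modulus_gt0 N49).
have : (modulus l <= 3 * (modulus l %/ 2))%N.
  by have := modulus_gt (lt49 l); lia.
rewrite -(ler_nat R) natrM; move: (_ %/ 2)%N%:R (ler0n R (modulus l %/ 2)).
move=> f f0 pf; rewrite -(ler_pM2l p0).
have := P_gt0; nra.
Qed.

Lemma sumE : \sum_l cw l * (w l)%:~R = M%:~R + P * q%:~R.
Proof.
rewrite -[P]/((Pprod N)%:~R) -intrM -intrD -hS rmorph_sum.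
by apply: eq_bigr => l _; rewrite [RHS]rmorphM.
Qed.

Lemma norm_quotient_le : `|q%:~R| <= sigma + 1 / 2.
Proof.
have P0 := P_gt0; have h := sum_weight_le.
rewrite -(ler_pM2r P0) -[X in _ * X](gtr0_norm P0) -normrM.
have -> : q%:~R * P = \sum_l cw l * (w l)%:~R - M%:~R by rewrite sumE; ring.
apply: le_trans (ler_normB _ _) _.
apply: le_trans (lerD (le_trans (ler_norm_sum _ _ _) h) hM) _.
have : 0 <= d * P by rewrite mulr_ge0 ?invr_ge0 ?exprn_ge0.
lra.
Qed.

Lemma norm_quotient_le_rho : `|q%:~R| <= rho.
Proof.
by apply: le_trans norm_quotient_le _; have := n_bounds; lra.
Qed.

Lemma quotient_correct (c : R) :
  `|c - \sum_l cw l * (w l)%:~R| <= d * P ->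
  rint (fl FP64 (Pinv R N * c)) = q.
Proof.
rewrite sumE => hc; apply: (rint_near hrint).
apply: (quotient_arith n_bounds rho_bounds (erefl _) u64E P_gt0 hM
  norm_quotient_le hc _ (fl_err FP64 _)).
rewrite [Pinv R N * c]mulrC -mulrBr !normrM mulrCA ler_wpM2l //.
exact: fl_err.
Qed.

(** An entry of [CRT64] depends on the matrices only through the residues [W l i j], here abstracted
    as [w l]. *)
Definition crt_entry b : R :=
  let c1 := fl_sum FP64 T1 (fun l => fl FP64 (s1 R b l * (w l)%:~R)) in
  let c2 := fl_sum FP64 T2 (fun l => fl FP64 (s2 R b l * (w l)%:~R)) in
  let z := (rint (fl FP64 (Pinv R N * c1)))%:~R in
  fma FP64 (- z) (P2 R b N) (fl FP64 (fma FP64 (- z) (P1 R N) c1 + c2)).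

Lemma P1_err : `|P - P1 R N| <= u * P.
Proof. by rewrite distrC -[X in _ * X](gtr0_norm P_gt0) fl_err. Qed.

Lemma N_gt0 : (0 < N)%N.
Proof. by case/andP: hN => /ltnW. Qed.

Lemma roundoff_pow_le :
  (1 + u) ^+ N.+1 - 1 <= (n + 1) * u + (n + 1) ^+ 2 * u ^+ 2.
Proof.
have u0 : 0 <= u := ltW (unit_roundoff_gt0 R FP64).
rewrite natr1; apply: expr1D_le => //; rewrite -natr1 /unit_roundoff /=.
by have := n_bounds; lra.
Qed.

Lemma crt_entry32_err : `|crt_entry FP32 - M%:~R| <= (n + 2) * u * rho * P.
Proof.
rewrite /crt_entry; set c1 := fl_sum _ T1 _; set c2 := fl_sum _ T2 _.
have -> : c2 = 0.
  rewrite /c2 -[RHS](fl_sum0 R FP64 T2); apply: eq_fl_sum => l.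
  by rewrite mul0r fl0.
(* As [c2] and [P2] vanish, the two outer roundings act on a rounded number, and only the inner
   [fma] contributes an error. *)
set z := rint _; rewrite addr0 /fma mulr0 add0r.
rewrite ![fl _ (fl _ _)]fl_fp; try exact: is_fp_fl.
have u0 : 0 <= u := ltW (unit_roundoff_gt0 R FP64).
have hc1 : `|c1 - \sum_l cw l * (w l)%:~R| <= u * P * ((n + 1) * sigma + 1 / 2).
  apply: le_trans (fl_sum_prod_err hT1 _ _ _ N_gt0) _.
  apply: le_trans (sum_err_arith n_bounds rho_bounds u64E P_gt0).
  apply: ler_pM roundoff_pow_le sum_weight_le.
  - by rewrite subr_ge0 exprn_ege1 // lerDl.
  - by rewrite sumr_ge0.
have zE : z = q.
  apply: quotient_correct; apply: le_trans hc1 _.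
  exact: (sum_err_small n_bounds rho_bounds (erefl _) u64E P_gt0).
rewrite zE.
have hM' : `|M%:~R| <= P / 2.
  apply: le_trans hM _; rewrite gerBl !mulr_ge0 ?invr_ge0 ?exprn_ge0 //.
apply: (crt32_arith n_bounds rho_bounds u64E P_gt0 hM' _ (fl_err FP64 _)).
set x := _ + c1.
(* The two error sources are the sum and the rounding of [P] to [P1]; the latter, multiplied by [q],
   raises the coefficient of [sigma] from [n + 1] to [n + 2]. *)
have -> : x - M%:~R = (c1 - \sum_l cw l * (w l)%:~R) + q%:~R * (P - P1 R N).
  by rewrite sumE /x; ring.
apply: le_trans (ler_normD _ _) _; rewrite normrM.
have := ler_pM (normr_ge0 _) (normr_ge0 _) norm_quotient_le P1_err.
by move: hc1; set X := `|_ - _|; set Y := `|_| * _; lra.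
Qed.

Local Notation t := (Num.ceil (log2 rho)).
Local Notation maxw := (@GRing.natmul R 1 (\max_(h < N) crt_weight h)).
Local Notation g := (Num.floor (log2 maxw) - 52 + t).
Local Notation z l := (Num.floor (cw l / 2 ^ g)).

Lemma maxw_bounds : 0 < maxw <= P * (1 - 1 / 256).
Proof.
have N0 : (0 < #|'I_N|)%N by rewrite card_ord; case/andP: hN; case: (N).
have [l ->] := bigop.eq_bigmax (fun l : 'I_N => crt_weight l) N0.
by rewrite crt_weight_leR ltr0n crt_weight_gt0.
Qed.

(* The exponent [g] does not depend on [l]: this is what makes the sum of the
   truncated terms exact. *)
Lemma s1_FP64 (l : 'I_N) : s1 R FP64 l = (z l)%:~R * 2 ^ g.
Proof.
rewrite /s1 /fround ger0_norm // /nbits.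
by set e := (e in 2 ^ e); have -> : e = g by rewrite /e; ring.
Qed.

Lemma s1_FP64_err (l : 'I_N) : 0 <= cw l - s1 R FP64 l <= 2 ^ g.
Proof.
by rewrite s1_FP64 floor_mul_bounds ?pow2_gt0.
Qed.

Lemma rho_le_pow2 : rho <= 2 ^ t.
Proof. by apply: log2_ceil_ge; have /andP[+ _] := rho_bounds; lra. Qed.

(** Every significand is at most [2 ^ (53 - t)], and the residues sum to at most [rho <= 2 ^ t] in
    absolute value; this is why [nbits] gives up [t] bits. *)
Lemma s1_sum_bound : \sum_l `|z l * w l| <= 2 ^+ 53.
Proof.
have g0 := pow2_gt0 R g; have /andP[m0 _] := maxw_bounds.
rewrite -(ler_int R) intr_pow2 rmorph_sum /=.
apply: le_trans (_ : \sum_(l < N) 2 ^ (53 - t) * (modulus l %/ 2)%:R <= _).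
  apply: ler_sum => l _; rewrite intr_norm intrM normrM.
  apply: ler_pM => //; last exact: normw.
  have z0 : 0 <= z l by rewrite floor_ge0 divr_ge0 // ltW.
  rewrite -intr_norm ger0_norm //.
  apply: le_trans (floor_le _) _; rewrite ler_pdivrMr // -pow2D.
  apply: le_trans (_ : maxw <= _); first by rewrite ler_nat leq_bigmax.
  have /andP[_ /ltW] := log2_floorP m0.
  by set f := Num.floor _; have -> : 53 - t + (f - 52 + t) = f + 1 by ring.
rewrite -mulr_sumr -natr_sum pow2B -mulrA ler_piMr ?exprn_ge0 //.
by rewrite mulrC ler_pdivrMr ?pow2_gt0 // mul1r rho_le_pow2.
Qed.

Lemma C1_FP64 :
  fl_sum FP64 T1 (fun l => fl FP64 (s1 R FP64 l * (w l)%:~R)) =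
  \sum_l s1 R FP64 l * (w l)%:~R.
Proof.
have h (l : 'I_N) : s1 R FP64 l * (w l)%:~R = (z l * w l)%:~R * 2 ^ g.
  by rewrite s1_FP64 (intrM _ (z l) (w l)) mulrAC.
have hb := s1_sum_bound; rewrite -(sum_leaves hT1) in hb.
rewrite (eq_fl_sum _ _ (G := fun l => (z l * w l)%:~R * 2 ^ g)); last first.
  move=> l; rewrite h fl_fp //; apply: is_fp_pow2 (erefl _) => //.
  apply: le_trans s1_sum_bound.
  by rewrite [X in _ <= X](bigD1 l) //= lerDl sumr_ge0.
rewrite fl_sum_exact // sum_leaves // rmorph_sum mulr_suml.
by apply: eq_bigr => l _; rewrite h.
Qed.

Local Notation r := (\sum_l (cw l - s1 R FP64 l) * (w l)%:~R).
Local Notation kappa := (2 ^ (1 + t) : R).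
Local Notation G := (rho * 2 ^ g : R).

Lemma residual_sum_le : \sum_l `|(cw l - s1 R FP64 l) * (w l)%:~R| <= G.
Proof.
rewrite mulrC [X in _ <= _ * X]natr_sum mulr_sumr; apply: ler_sum => l _.
have /andP[h1 h2] := s1_FP64_err l.
by rewrite normrM ler_pM ?normw // ger0_norm.
Qed.

Lemma kappa_bounds : 2 * rho <= kappa <= 2 ^+ 13.
Proof.
have /andP[r1 r2] := rho_bounds.
rewrite pow2D expr1z ler_pM2l // rho_le_pow2 /= exprS ler_pM2l //.
rewrite exprnP ler_eXz2l ?ltr1n // ceil_le_int.
rewrite -log2_pow2 -exprnP; apply: ler_log2 => //.
by lra.
Qed.

(** [2 ^ g] equals [kappa u] times the leading power of two of the largest weight, and that weight
    stays below [P (1 - 1 / 256)]. This creates the gap used in [crt64_arith]. *)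
Lemma G_le : G <= kappa * u * rho * P * (1 - 1 / 256).
Proof.
have /andP[m0 mP] := maxw_bounds; have /andP[h _] := log2_floorP m0.
have u0 : 0 < u := unit_roundoff_gt0 R FP64.
have -> : 2 ^ g = kappa * u * 2 ^ Num.floor (log2 maxw).
  have -> : u = 2 ^ (- 53%:Z) by rewrite -invr_expz.
  by rewrite -!pow2D; congr (2 ^ _); ring.
rewrite mulrC -!mulrA; apply: ler_wpM2l; first exact/ltW/pow2_gt0.
apply: ler_wpM2l; first exact: ltW.
by rewrite mulrC; apply: ler_wpM2l => //; apply: le_trans h mP.
Qed.

Lemma crt_entry64_err : `|crt_entry FP64 - M%:~R| <=
  (n + 2) * u * (kappa * u * rho * P) + 3 * u * `|M%:~R|.
Proof.
have u0 : 0 <= u := ltW (unit_roundoff_gt0 R FP64).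
rewrite /crt_entry C1_FP64; set c1 := \sum_l _.
set c2 := fl_sum _ T2 _; set x := rint _.
have hr : `|r| <= G := le_trans (ler_norm_sum _ _ _) residual_sum_le.
have c1E : c1 = M%:~R + P * q%:~R - r.
  by rewrite -sumE -sumrB; apply: eq_bigr => l _; ring.
have hM' : `|M%:~R| <= P / 2.
  by apply: le_trans hM _; rewrite gerBl !mulr_ge0 ?invr_ge0 ?exprn_ge0.
(* The first sum is exact, so [c1] misses the remainder sum by [r] alone, and [|r| <= G] is within
   the tolerance [d P]. *)
have xE : x = q.
  apply: quotient_correct; rewrite sumE c1E addrAC subrr add0r normrN.
  apply: le_trans (le_trans hr G_le) _.
  exact: (truncation_arith_weak rho_bounds (erefl _) u64E P_gt0 kappa_bounds).
have hc : `|c2 - r| <= (n + 1) * u * (1 + 1 / 2 ^+ 10) * G.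
  apply: le_trans (fl_sum_prod_err hT2 _ _ _ N_gt0) _.
  have G0 : 0 <= G by rewrite mulr_ge0 // ltW ?pow2_gt0.
  apply: le_trans (_ : ((n + 1) * u + (n + 1) ^+ 2 * u ^+ 2) * G <= _).
    apply: ler_pM roundoff_pow_le residual_sum_le.
    - by rewrite subr_ge0 exprn_ege1 // lerDl.
    - by rewrite sumr_ge0.
  by rewrite ler_wpM2r // (roundoff_arith n_bounds u64E).
(* [a] is the effect of rounding [P] to [P1]; the last [fma] removes it with [P2], up to the
   second-order [p] below. *)
rewrite xE; set a := q%:~R * (P - P1 R N).
have hq := norm_quotient_le_rho.
have ha : `|a| <= rho * (u * P) by rewrite normrM ler_pM // P1_err.
pose p := q%:~R * (P2 R FP64 N - (P - P1 R N)).
have hp : `|p| <= rho * (u * (u * P)).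
  rewrite normrM ler_pM //; apply: le_trans (fl_err FP64 _) _.
  by rewrite ler_wpM2l // P1_err.
set x1 := fma FP64 _ (P1 R N) c1; set x2 := fl FP64 (x1 + c2).
apply: (crt64_arith (x1 := x1) (x2 := x2) (p := p) n_bounds rho_bounds (erefl _)
  u64E P_gt0 kappa_bounds hM' (erefl _) hr G_le ha hp hc _ (fl_err FP64 _)).
  rewrite /x1 /fma (_ : - q%:~R * P1 R N + c1 = M%:~R - r + a) ?fl_err //.
  by rewrite c1E /a; ring.
rewrite /fma (_ : - q%:~R * P2 R FP64 N + x2 = x2 - (a + p)) ?fl_err //.
by rewrite /p /a; ring.
Qed.

End CRTError.

(** * Choice of the scaling exponents *)

Section C0.
Variable R : realType.

Lemma u32E : 4 * unit_roundoff FP32 = 2 ^- 22 :> R.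
Proof. by rewrite /unit_roundoff /=; lra. Qed.

Lemma fl_down32_err (x : R) : `|fl_down FP32 x - x| <= 2 ^- 23 * `|x|.
Proof. exact: fl_down_err. Qed.

Lemma c0_arg_bounds : let y : R := 1 / 2 / (1 - 2 ^- 22) in
  1 / 2 + 1 / 2 ^+ 23 < y <= 1 / 2 + 1 / 2 ^+ 22.
Proof.
have h : (0 : R) < 1 - 2 ^- 22 by lra.
by rewrite /= ltr_pdivlMr // ler_pdivrMr //; apply/andP; split; lra.
Qed.

(** The argument is [- y] with [y] slightly above [1 / 2 + 2 / 2 ^ 24], where FP32 numbers are
    spaced by [2 ^ -24]. Rounding down therefore gains almost a full unit. *)
Lemma c0_le : c0 R <= - (1 / 2 + 3 / 2 ^+ 24).
Proof.
rewrite /c0 u32E mulNr; have /andP[] := c0_arg_bounds; set y := _ / (1 - _).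
move=> h1 h2; rewrite /fl_down /fround normrN ger0_norm; last by lra.
have -> : Num.floor (log2 y) = - 1.
  apply: floor_def; rewrite addNr -log2_pow2 -(log2_pow2 R 0) expr0z.
  rewrite ler_log2 ?pow2_gt0 //=; last by rewrite exprN1; lra.
  rewrite log2_1 /log2 pmulr_llt0 ?invr_gt0 ?ln2_gt0 //.
  by apply: ln_lt0; lra.
have -> : - 1 - (prec FP32)%:Z + 1 = - 24%:Z by [].
rewrite -invr_expz -exprnP; set z := Num.floor _.
have : z <= - (2 ^+ 23 + 3).
  rewrite -ltzD1 -(ltr_int R) /z; apply: le_lt_trans (floor_le _) _.
  by rewrite intrD mulrNz intrD intr_pow2 invrK; lra.
by rewrite -(ler_int R) mulrNz intrD intr_pow2; lra.
Qed.

Lemma c0_ge : - (1 / 2 + 1 / 2 ^+ 20) <= c0 R.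
Proof.
rewrite /c0 u32E mulNr; have /andP[] := c0_arg_bounds; set y := _ / (1 - _).
move=> h1 h2; have := fl_down32_err (- y).
rewrite normrN (ger0_norm (x := y)); last by lra.
rewrite ler_norml => /andP[h _]; lra.
Qed.

End C0.

Section Exponent.
Variables (R : realType) (log2f : R -> R) (hlog2f : log2f_accurate log2f).
Variables (N : nat) (hN : (2 <= N <= 49)%N).

Local Notation P := (@GRing.natmul R 1 (Pprod N)).
Local Notation P0 := (1 / 2 * log2 (P - 1) - 1 / 2).

Lemma Pscale_arg_bounds : 0 <= P0 <= 196.
Proof.
have h2 : 2 <= P - 1 by have := Pprod_gt2 hN; rewrite -(ler_nat R); lra.
have h1 : P - 1 <= 2 ^ 392%:Z.
  have : P <= (2 ^ 392)%N%:R by rewrite ler_nat Pprod_le //; case/andP: hN.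
  by rewrite natrX -exprnP; lra.
have := ler_log2 (ltr0Sn R 1) h2; rewrite log2_2 => h3.
have := ler_log2 (lt_le_trans (ltr0Sn R 1) h2) h1; rewrite log2_pow2 => h4.
have h5 : 392%:Z%:~R <= 392 :> R by [].
by apply/andP; split; lra.
Qed.

Lemma Pscale_bounds : P0 - 1 / 2 ^+ 10 <= Pscale R N <= P0.
Proof.
rewrite /Pscale fl_down_le andbT.
have /andP[h1 h2] := Pscale_arg_bounds.
have := fl_down32_err P0; set y := P0 in h1 h2 *.
rewrite (ger0_norm h1) ler_norml.
by move=> /andP[h _]; lra.
Qed.

(** The amount added to [mu'] or [nu']. Below, [c] stands for the maximum of a row or column of
    [Cbar], and [d] for that of [Dbar]. *)
Definition shift (d : R) : int :=
  Num.floor (fma_down FP32 (c0 R) (log2f d) (Pscale R N)).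

Variables (c d : R).
Hypotheses (c1 : 1 <= c) (c29 : c <= 2 ^+ 29) (cd : c <= d <= 2 * c).
Hypothesis (dfp : is_fp (prec FP32) d).

Let d1 : 1 <= d. Proof. by case/andP: cd => h _; exact: le_trans h. Qed.

Lemma log2_c_bounds : 0 <= log2 c <= 29.
Proof.
rewrite log2_ge0 //=; have := ler_log2 _ c29.
by rewrite exprnP log2_pow2; apply; exact: lt_le_trans c1.
Qed.

Lemma log2_d_bounds : log2 c <= log2 d <= log2 c + 1.
Proof.
have c0 : 0 < c := lt_le_trans ltr01 c1.
have /andP[h1 h2] := cd; rewrite ler_log2 //= addrC -log2_2 -log2M //.
by rewrite ler_log2 // (lt_le_trans c0).
Qed.

Lemma log2f_bounds :
  (1 - 2 ^- 22) * log2 d <= log2f d <= (1 + 2 ^- 22) * log2 d.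
Proof.
have [_] := hlog2f dfp d1; rewrite u32E ler_norml => /andP[h1 h2].
by apply/andP; split; lra.
Qed.

(** The error of [log2f] costs a factor [1 - 2 ^ -22], that is, about two of the three units
    [2 ^ -24] in [c0]; [2 ^ -25] is a safe part of the remaining one. *)
Lemma shift_le : (shift d)%:~R <= P0 - (1 / 2 + 1 / 2 ^+ 25) * log2 c.
Proof.
apply: le_trans (floor_le _) _; apply: le_trans (fl_down_le _ _) _.
have /andP[_ h1] := Pscale_bounds; have /andP[h2 _] := log2f_bounds.
have /andP[h3 _] := log2_d_bounds; have /andP[h4 _] := log2_c_bounds.
have h5 := c0_le R.
set x := c0 R in h5 *; set y := log2f d in h2 *; set L := log2 d in h2 h3.
set l := log2 c in h3 h4 *.
have h6 : (1 - 2 ^- 22) * l <= y by lra.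
have h7 : 0 <= y by apply: le_trans h6; rewrite mulr_ge0 //; lra.
have : x * y <= - (1 / 2 + 3 / 2 ^+ 24) * y by rewrite ler_wpM2r.
move: h1; set p := Pscale R N; set q := P0; lra.
Qed.

(** Of the [5 / 2], the summand of [Pscale] takes [1 / 2], [d <= 2 c] takes [1 / 2] and the floor
    takes [1]; the last [1 / 2] covers the rounding errors. It is the exact loss that
    [shift_scale_le] allows. *)
Lemma shift_ge : 1 / 2 * log2 (P - 1) - 1 / 2 * log2 c - 5 / 2 <= (shift d)%:~R.
Proof.
have /andP[p1 p2] := Pscale_bounds; have /andP[f1 f2] := log2f_bounds.
have /andP[d2 d3] := log2_d_bounds; have /andP[l1 l2] := log2_c_bounds.
have /andP[q1 q2] := Pscale_arg_bounds.
have x1 := c0_le R; have x2 := c0_ge R.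
rewrite /shift /fma_down; move: (c0 R) (log2f d) x1 x2 f1 f2 => x z x1 x2 f1 f2.
set y := x * z + _; have := floorD1_gt (fl_down FP32 y); rewrite intrD.
have := fl_down32_err y; set F := Num.floor _; rewrite ler_norml => /andP[e1 _].
have z0 : 0 <= z by apply: le_trans f1; rewrite mulr_ge0 //; lra.
have z30 : z <= log2 c + 1 + 1 / 2 ^+ 10 by lra.
have xz : - (1 / 2 + 1 / 2 ^+ 20) * z <= x * z by rewrite ler_wpM2r.
have xz0 : x * z <= 0 by rewrite nmulr_rle0 //; lra.
have hy : `|y| <= 256 by rewrite ler_norml /y; apply/andP; split; lra.
have : y = x * z + Pscale R N by [].
have : 2 ^- 23 * `|y| <= 2 ^- 23 * 256 by rewrite ler_wpM2l // invr_ge0 exprn_ge0.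
lra.
Qed.

(** Since [F] is an integer, [2 * 4 ^ F] is a power of two, so it is at most the leading power
    [2 ^ L] of [P - 1] and inherits its gap. *)
Lemma binary_gapR (F : int) :
  2 * (2 ^ F * 2 ^ F) <= P - 1 -> 2 ^ F * 2 ^ F * (1 + 1 / 2 ^+ 20) <= (P - 1) / 2.
Proof.
have PE : (Pprod N).-1%:R = P - 1 :> R.
  by rewrite -[Pprod N in RHS]prednK ?(ltn_trans _ (Pprod_gt2 hN)) // -natr1 addrK.
have [L []] := Pprod_binary_gap hN.
rewrite -(ler_nat R) -(ltr_nat R) natrD (natrM _ (2 ^ L)) (natrM _ (2 ^ 20)).
rewrite PE !natrX => h1 h2 h3.
have h4 : 1 + F + F <= L%:Z.
  rewrite -ltzD1 -(ltr_eXz2l (x := 2 : R)) ?ltr1n //.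
  rewrite !pow2D expr1z -mulrA; apply: le_lt_trans h3 _.
  by apply: lt_le_trans h2 _; rewrite exprSr -exprnP.
rewrite -(ler_eXz2l (x := 2 : R)) ?ltr1n // !pow2D expr1z -exprnP in h4.
move: h1 h4; set X := 2 ^ F; set Y := 2 ^+ L; lra.
Qed.

Lemma shift_sqr_le : c = 1 \/ 2 <= c ->
  2 ^ shift d * 2 ^ shift d * c * (1 + 1 / 2 ^+ 25) <= (P - 1) / 2.
Proof.
move=> c12; have h := shift_le; have /andP[l0 _] := log2_c_bounds.
move: (shift d) h => F h; have c0 : 0 < c := lt_le_trans ltr01 c1.
have hP : 2 < P by rewrite (ltr_nat R 2) Pprod_gt2.
have P1 : 0 < (P - 1) / 2 by lra.
have PE : (P - 1) / 2 = 2 `^ (2 * P0).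
  rewrite -[LHS]powR_log2 //; congr (_ `^ _).
  by have := log2M P1 (ltr0Sn R 1); rewrite divfK ?pnatr_eq0 // log2_2 => ->; lra.
have FE : 2 ^ F * 2 ^ F * c = 2 `^ (2 * F%:~R + log2 c).
  rewrite !powRD ?pnatr_eq0 ?implybT // powR_log2 //; congr (_ * _).
  by rewrite mulrDl mul1r powRD ?pnatr_eq0 ?implybT // powR_pow2.
have hle e : 0 <= e -> 2 * F%:~R + log2 c + e <= 2 * P0 ->
    2 ^ F * 2 ^ F * c * (1 + e / 2) <= (P - 1) / 2.
  move=> e0 he; rewrite PE; apply: le_trans (ler_powR _ he); last by rewrite ler1n.
  rewrite powRD ?pnatr_eq0 ?implybT // -FE.
  by rewrite ler_pM2l ?powR2_ge1D // !mulr_gt0 ?pow2_gt0.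
(* For [c = 1] the logarithm vanishes and [shift_le] gives no excess, so integrality of the exponent
   has to provide the factor. *)
case: c12 => [c1'|c2].
  have hb : 2 * (2 ^ F * 2 ^ F) <= P - 1.
    have := hle 0 (lexx 0); rewrite c1' log2_1 !mulr1 mul0r !addr0 mulr1 in h *.
    by move=> /(_ ltac:(lra)); lra.
  have := binary_gapR hb; have : 0 <= 2 ^ F * 2 ^ F :> R.
    by rewrite mulr_ge0 ?ltW ?pow2_gt0.
  by rewrite c1' mulr1; set X := 2 ^ F; lra.
(* The excess in the exponent is [2 * 2 ^ -25 * log2 c >= 2 ^ -24]. *)
have l1 : 1 <= log2 c by rewrite -log2_2 ler_log2.
have -> : 1 / 2 ^+ 25 = 1 / 2 ^+ 24 / 2 :> R by lra.
by apply: hle; lra.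
Qed.

Lemma shift_scale_le (al : int) :
  2 ^ (- (5 - al + shift d)) <=
    1 / Num.sqrt (2 ^+ 5 * (P - 1)) * 2 `^ (al%:~R + 1 / 2 * log2 c).
Proof.
have hP : 2 < P by rewrite (ltr_nat R 2) Pprod_gt2.
have P1 : 0 < P - 1 by lra.
set s := 2 `^ ((5 + log2 (P - 1)) / 2).
have sE : Num.sqrt (2 ^+ 5 * (P - 1)) = s.
  have -> : 2 ^+ 5 * (P - 1) = s ^+ 2.
    rewrite expr2 -powRD ?pnatr_eq0 ?implybT // -splitr powRD ?pnatr_eq0 ?implybT //.
    by rewrite powR_log2 // (powR_mulrn 5).
  by rewrite sqrtr_sqr ger0_norm // powR_ge0.
rewrite sE mul1r -[s^-1]powRN -powRD ?pnatr_eq0 ?implybT // -powR_pow2.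
rewrite ler_powR ?ler1n // mulrNz (intrD _ (5 - al)) (intrB _ 5).
by have := shift_ge; move: (shift d) => F; rewrite -[5%:~R]/(5 : R); lra.
Qed.

End Exponent.

(** * Entrywise bound *)

Section ScaledEntries.
Variable R : realType.
Implicit Types (x y a : R).

Lemma rtrunc_bounds y : `|(rtrunc y)%:~R| <= `|y| /\ `|y - (rtrunc y)%:~R| <= 1.
Proof.
rewrite /rtrunc; case: ifPn => [y0|]; last rewrite -ltNge => y0.
  have /andP[h1 h2] := floor_itv y; rewrite intrD in h2.
  have h3 : 0 <= (Num.floor y)%:~R :> R by rewrite ler0z floor_ge0.
  by rewrite !ger0_norm ?subr_ge0 //; split; lra.
have /andP[h1 h2] := ceil_itv y; rewrite intrB in h1.
have h3 : (Num.ceil y)%:~R <= 0 :> R by rewrite lerz0 ceil_le0 ltW.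
by rewrite !ler0_norm ?subr_le0 ?(ltW y0) //; split; lra.
Qed.

Lemma scaled_ceil_bounds x a : 0 <= x <= a ->
  0 <= Num.ceil (2 ^ (5 - Num.floor (log2 a)) * x) <= 2 ^+ 6.
Proof.
move=> /andP[x0 xa]; have [a0|a0] := ltP 0 a; last first.
  by have -> : x = 0 by [lra]; rewrite mulr0 (intrKceil 0).
rewrite ceil_ge0 (lt_le_trans (ltrN10 R)) ?mulr_ge0 ?(ltW (pow2_gt0 _ _)) //=.
rewrite ceil_le_int; have /andP[_ /ltW h] := log2_floorP a0.
apply: le_trans (ler_wpM2l (ltW (pow2_gt0 R _)) (le_trans xa h)) _.
by rewrite -pow2D subrKA intr_pow2 exprnP.
Qed.

(** The positive entry at [h0] keeps the maxima away from 0, where [log2f] is unspecified. Both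
    maxima are attained, so [c] is an integer and [d] a floating-point number; [d <= 2 c] is a crude
    form of the rounding error. *)
Lemma max_fl_up n (z : 'I_n -> int) h0 :
  (forall h, 0 <= z h <= 2 ^+ 29) -> 0 < z h0 ->
  let c : R := \big[Num.max/0]_h (z h)%:~R in
  let d : R := \big[Num.max/0]_h fl_up FP32 (z h)%:~R in
  [/\ 1 <= c <= 2 ^+ 29, c = 1 \/ 2 <= c, c <= d <= 2 * c,
      is_fp (prec FP32) d & forall h, (z h)%:~R <= c].
Proof.
move=> hz hz0 c d.
have z0 h : 0 <= (z h)%:~R :> R by rewrite ler0z; case/andP: (hz h).
have f0 h : 0 <= fl_up FP32 (z h)%:~R :> R := le_trans (z0 h) (fl_up_ge _ _).
have [h1 _ cE] := eq_bigmax (x := 0 : R) h0 predT _ isT (fun h _ => z0 h).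
have [h2 _ dE] := eq_bigmax (x := 0 : R) h0 predT _ isT (fun h _ => f0 h).
have lec h : (z h)%:~R <= c by exact: le_bigmax.
have led h : fl_up FP32 (z h)%:~R <= d by exact: le_bigmax.
have c1 : 1 <= c by apply: le_trans (lec h0); rewrite ler1z.
rewrite -/c in cE; rewrite -/d in dE; split => //.
- rewrite c1 cE -intr_pow2 ler_int; by case/andP: (hz h1).
- rewrite cE ler1z in c1; rewrite cE.
  have [->|h] : z h1 = 1 \/ 2 <= z h1 by lia.
    by left.
  by right; rewrite -[2]/(2%:~R) ler_int.
- apply/andP; split; first by rewrite {1}cE; apply: le_trans (led h1); exact: fl_up_ge.
  have he : 2 ^ (1 - (prec FP32)%:Z) <= 1 :> R.
    by rewrite -[1 - _]/(- 23%:Z) -invr_expz -exprnP; lra.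
  have := fl_up_err FP32 ((z h2)%:~R : R); rewrite -dE (ger0_norm (z0 h2)).
  move=> /le_trans/(_ (ler_wpM2r (z0 h2) he)).
  rewrite mul1r => /(le_trans (ler_norm _)); rewrite lerBlDr -mulr2n.
  by move=> /le_trans; apply; rewrite mulr_natl lerMn2r lec.
- by rewrite dE; exact: is_fp_fl_up.
Qed.

(** The geometric mean of the row bound and the column bound: the square of the left side is the
    product of the two. *)
Lemma sqr_bound_arith (x y ci cj cij q e : R) :
  0 <= x -> 0 <= y -> 0 <= cij -> cij <= ci -> cij <= cj -> 0 <= e ->
  x * x * ci * (1 + e) <= q -> y * y * cj * (1 + e) <= q ->
  x * y * cij * (1 + e) <= q.
Proof.
move=> x0 y0 c0 ci_ cj_ e0 hx hy.
have e1 : 0 <= 1 + e by lra.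
have q0 : 0 <= q by apply: le_trans hx; rewrite !mulr_ge0 // (le_trans c0).
rewrite -(ler_pXn2r (n := 2)) ?nnegrE ?mulr_ge0 //.
have -> : (x * y * cij * (1 + e)) ^+ 2
  = (x * x * cij * (1 + e)) * (y * y * cij * (1 + e)) by ring.
rewrite expr2; apply: ler_pM; rewrite ?mulr_ge0 //.
  by apply: le_trans hx; rewrite ler_wpM2r // ler_wpM2l // mulr_ge0.
by apply: le_trans hy; rewrite ler_wpM2r // ler_wpM2l // mulr_ge0.
Qed.

(** Uses [1 / (1 + 2 ^ -25) <= 1 - 2 ^ -26]. *)
Lemma half_arith (x y p : R) : 0 <= x -> x <= y -> 0 <= p ->
  y * (1 + 1 / 2 ^+ 25) <= (p - 1) / 2 -> x <= p / 2 - 2 * 2 ^- 28 * p.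
Proof. lra. Qed.

(* [a b - s s' a' b' = (a - s a') b + a (b - s' b') - (a - s a') (b - s' b')] *)
Lemma scaled_product_err k (a b : 'I_k -> R) (a' b' : 'I_k -> int) (s s' : R) :
  (forall h, `|a h - s * (a' h)%:~R| <= s) ->
  (forall h, `|b h - s' * (b' h)%:~R| <= s') ->
  `|\sum_h a h * b h - s * s' * (\sum_h a' h * b' h)%:~R| <=
    s' * (\sum_h `|a h|) + s * (\sum_h `|b h|) + k%:R * (s * s').
Proof.
move=> ha hb; rewrite rmorph_sum !mulr_sumr -sumrB.
apply: le_trans (ler_norm_sum _ _ _) _.
have -> : k%:R * (s * s') = \sum_(h < k) s * s'.
  by rewrite sumr_const card_ord mulr_natl.
rewrite -!big_split /=; apply: ler_sum => h _; rewrite intrM.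
have := ha h; have := hb h.
set x := a h - _; set y := b h - _ => hy hx.
have -> : a h * b h - s * s' * ((a' h)%:~R * (b' h)%:~R)
  = a h * y + x * b h - x * y by rewrite /x /y; ring.
apply: le_trans (ler_normB _ _) _; rewrite lerD //; last by rewrite normrM ler_pM.
apply: le_trans (ler_normD _ _) _; rewrite !normrM lerD //.
  by rewrite mulrC ler_wpM2r.
by rewrite ler_wpM2r.
Qed.

Lemma scaled_trunc_err (e : int) a :
  `|a - 2 ^ (- e) * (rtrunc (2 ^ e * a))%:~R| <= 2 ^ (- e).
Proof.
have e0 := pow2_gt0 R e; have e0' := pow2_gt0 R (- e).
have {1}-> : a = 2 ^ (- e) * (2 ^ e * a) by rewrite mulrA -pow2D addNr mul1r.
rewrite -mulrBr normrM gtr0_norm //; apply: ler_piMr; first exact: ltW.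
by have [] := rtrunc_bounds (2 ^ e * a).
Qed.

End ScaledEntries.

Lemma Rbound32E (R : realType) N m k n (A' : 'M[int]_(m, k)) (B' : 'M_(k, n)) i j :
  Rbound R N FP32 A' B' i j =
  (1 + unit_roundoff FP32) * (N%:R + 2) * unit_roundoff FP64 * (rho N)%:R
    * (Pprod N)%:R + unit_roundoff FP32 * `|((A' *m B') i j)%:~R|.
Proof. by rewrite /Rbound; move: (A' *m B') => M; rewrite !mxE mulr1. Qed.

Lemma Rbound64E (R : realType) N m k n (A' : 'M[int]_(m, k)) (B' : 'M_(k, n)) i j :
  Rbound R N FP64 A' B' i j =
  (1 + 3 * unit_roundoff FP64) * 2 ^ (1 + Num.ceil (log2 ((rho N)%:R : R)))
    * (N%:R + 2) * unit_roundoff FP64 ^+ 2 * (rho N)%:R * (Pprod N)%:R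
  + 3 * unit_roundoff FP64 * `|((A' *m B') i j)%:~R|.
Proof. by rewrite /Rbound; move: (A' *m B') => M; rewrite !mxE mulr1. Qed.

(** The final rounding to FP32 is the source of the factor [1 + u32] and of the term
    [u32 |A' B'|]. *)
Lemma single_rounding_err (R : realType) (y M r : R) : `|y - M| <= r ->
  `|fl FP32 y - M| <= (1 + unit_roundoff FP32) * r + unit_roundoff FP32 * `|M|.
Proof.
move=> h; have u0 := ltW (unit_roundoff_gt0 R FP32).
have := ler_distD y (fl FP32 y) M; have := fl_err FP32 y.
have := ler_normD (y - M) M; rewrite subrK => h1.
have : unit_roundoff FP32 * `|y| <= unit_roundoff FP32 * (`|M| + r).
  by rewrite ler_wpM2l //; lra.
lra.
Qed.

(** * One entry of the scaled product and of its reconstruction *)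

Section Entry.
Variables (R : realType) (rint : R -> int) (log2f : R -> R) (b : format).
Variables (N m k n : nat) (T1 T2 : sum_tree 'I_N).
Variables (A : 'M[R]_(m, k)) (B : 'M[R]_(k, n)).
Hypotheses (hrint : nearest_int rint) (hlog2f : log2f_accurate log2f).
Hypotheses (hT1 : sum_order T1) (hT2 : sum_order T2).
Hypotheses (hN : (2 <= N <= 49)%N) (hk : (k <= 2 ^ 17)%N).

Local Notation Ai := (Aint log2f N A B).
Local Notation Bi := (Bint log2f N A B).
Local Notation mu := (mu log2f N A B).
Local Notation nu := (nu log2f N A B).
Local Notation P := (@GRing.natmul R 1 (Pprod N)).
Local Notation t := (1 / Num.sqrt (2 ^+ 5 * (P - 1))).

Lemma Abar_bounds i h : 0 <= Abar A i h <= 2 ^+ 6.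
Proof.
rewrite mxE scaled_ceil_bounds // normr_ge0 /rowmax.
have := @le_bigmax _ _ _ 0 (fun h => absmx A i h) h; by rewrite mxE.
Qed.

Lemma Bbar_bounds h j : 0 <= Bbar B h j <= 2 ^+ 6.
Proof.
rewrite mxE mulrC scaled_ceil_bounds // normr_ge0 /colmax.
have := @le_bigmax _ _ _ 0 (fun h => absmx B h j) h; by rewrite mxE.
Qed.

Lemma Cbar_bounds i j : 0 <= Cbar A B i j <= 2 ^+ 29.
Proof.
rewrite mxE; apply/andP; split.
  apply: sumr_ge0 => h _; rewrite mulr_ge0 //.
    by case/andP: (Abar_bounds i h).
  by case/andP: (Bbar_bounds h j).
apply: le_trans (ler_sum_ord (c := 2 ^+ 6 * 2 ^+ 6) _) _ => [h|].
  case/andP: (Abar_bounds i h) (Bbar_bounds h j) => a0 a1 /andP[b0 b1].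
  exact: ler_pM.
rewrite natz; have : k%:Z <= 2 ^+ 17.
  by have := hk; rewrite -lez_nat -[(2 ^ 17)%N%:Z]natz natrX.
move=> hk'; apply: le_trans (ler_wpM2r _ hk') _; first by rewrite mulr_ge0 ?exprn_ge0.
have e (x : int) : x ^+ 17 * (x ^+ 6 * x ^+ 6) = x ^+ 29 by rewrite -!exprD.
by rewrite e lexx.
Qed.

Local Notation F i := (shift log2f N (rowmax (Dbar A B) i)).
Local Notation G j := (shift log2f N (colmax (Dbar A B) j)).

(** Truncation does not increase absolute values, and the ceiling in [Abar] dominates [2 ^ mu' |A|];
    only the shift remains as a factor. *)
Lemma Aint_le i h : `|(Ai i h)%:~R| <= 2 ^ F i * (Abar A i h)%:~R :> R.
Proof.
rewrite !mxE; have [h1 _] := rtrunc_bounds (2 ^ mu i * A i h).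
apply: le_trans h1 _; rewrite normrM (gtr0_norm (pow2_gt0 _ _)).
rewrite -[mu i]/(mu' A i + F i) addrC pow2D -mulrA.
by rewrite ler_wpM2l ?ceil_ge // ltW // pow2_gt0.
Qed.

Lemma Bint_le h j : `|(Bi h j)%:~R| <= 2 ^ G j * (Bbar B h j)%:~R :> R.
Proof.
rewrite !mxE; have [h1 _] := rtrunc_bounds (B h j * 2 ^ nu j).
apply: le_trans h1 _; rewrite normrM (gtr0_norm (pow2_gt0 _ _)).
rewrite -[nu j]/(nu' B j + G j) pow2D mulrA mulrC.
by rewrite ler_wpM2l ?ceil_ge // ltW // pow2_gt0.
Qed.

Lemma product_le i j :
  `|((Ai *m Bi) i j)%:~R| <= 2 ^ F i * 2 ^ G j * (Cbar A B i j)%:~R :> R.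
Proof.
rewrite [X in X%:~R]mxE rmorph_sum [X in _ <= _ * X%:~R]mxE rmorph_sum mulr_sumr.
apply: le_trans (ler_norm_sum _ _ _) _; apply: ler_sum => h _.
rewrite !rmorphM /= normrM mulrACA.
by rewrite ler_pM // ?Aint_le ?Bint_le.
Qed.

Section Nonzero.
Variables (i : 'I_m) (j : 'I_n).
Hypothesis hC : 0 < Cbar A B i j.

Lemma rowmaxP :
  let c := rowmax (intmx R (Cbar A B)) i in let d := rowmax (Dbar A B) i in
  [/\ 1 <= c <= 2 ^+ 29, c = 1 \/ 2 <= c, c <= d <= 2 * c,
      is_fp (prec FP32) d & forall h, (Cbar A B i h)%:~R <= c].
Proof.
rewrite /rowmax.
have -> : \big[Num.max/0]_h intmx R (Cbar A B) i h
    = \big[Num.max/0]_h (Cbar A B i h)%:~R by apply: eq_bigr => h _; rewrite mxE.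
have -> : \big[Num.max/0]_h Dbar A B i h
    = \big[Num.max/0]_h fl_up FP32 (Cbar A B i h)%:~R.
  by apply: eq_bigr => h _; rewrite mxE mxE.
exact: (@max_fl_up R n (fun h => Cbar A B i h) j (fun h => Cbar_bounds i h) hC).
Qed.

Lemma colmaxP :
  let c := colmax (intmx R (Cbar A B)) j in let d := colmax (Dbar A B) j in
  [/\ 1 <= c <= 2 ^+ 29, c = 1 \/ 2 <= c, c <= d <= 2 * c,
      is_fp (prec FP32) d & forall h, (Cbar A B h j)%:~R <= c].
Proof.
rewrite /colmax.
have -> : \big[Num.max/0]_h intmx R (Cbar A B) h j
    = \big[Num.max/0]_h (Cbar A B h j)%:~R by apply: eq_bigr => h _; rewrite mxE.
have -> : \big[Num.max/0]_h Dbar A B h j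
    = \big[Num.max/0]_h fl_up FP32 (Cbar A B h j)%:~R.
  by apply: eq_bigr => h _; rewrite mxE mxE.
exact: (@max_fl_up R m (fun h => Cbar A B h j) i (fun h => Cbar_bounds h j) hC).
Qed.

Lemma inverse_scaling_row_le :
  2 ^ (- mu i) <= t * pow2 (alpha' A B) i 0.
Proof.
have [/andP[c1 c29] _ cd dfp _] := rowmaxP.
have := shift_scale_le hlog2f hN c1 c29 cd dfp (Num.floor (log2 (rowmax (absmx A) i))).
by rewrite !mxE.
Qed.

Lemma inverse_scaling_col_le :
  2 ^ (- nu j) <= t * pow2 (beta' A B) j 0.
Proof.
have [/andP[c1 c29] _ cd dfp _] := colmaxP.
have := shift_scale_le hlog2f hN c1 c29 cd dfp (Num.floor (log2 (colmax (absmx B) j))).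
by rewrite !mxE.
Qed.

Lemma product_lt_half :
  `|((Ai *m Bi) i j)%:~R| <= P / 2 - 2 * 2 ^- 28 * P.
Proof.
have [/andP[c1 c29] c12 cd dfp cle] := rowmaxP.
have [/andP[c1' c29'] c12' cd' dfp' cle'] := colmaxP.
have h1 := shift_sqr_le hlog2f hN c1 c29 cd dfp c12.
have h2 := shift_sqr_le hlog2f hN c1' c29' cd' dfp' c12'.
have hp := product_le i j.
have C0 : 0 <= (Cbar A B i j)%:~R :> R by rewrite ler0z ltW.
have e0 : 0 <= 1 / 2 ^+ 25 :> R by rewrite divr_ge0 // exprn_ge0.
have := sqr_bound_arith (ltW (pow2_gt0 R _)) (ltW (pow2_gt0 R _)) C0
  (cle j) (cle' i) e0 h1 h2.
exact: half_arith (normr_ge0 _) hp (ler0n _ _).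
Qed.

End Nonzero.

Local Notation w i j := (fun l => W rint Ai Bi l i j).
Local Notation CC := (CRT rint b T1 T2 Ai Bi).

Lemma CRT64E c i j :
  CRT64 rint c T1 T2 Ai Bi i j = crt_entry rint T1 T2 (w i j) c.
Proof. by rewrite !mxE. Qed.

Lemma is_fp_CRT i j : is_fp (prec b) (CC i j).
Proof.
rewrite /CRT; case: b; last by rewrite mxE; exact: is_fp_fl.
by rewrite mxE; exact: is_fp_fl.
Qed.

(** With unbounded exponents, multiplying a floating-point number by a power of two is exact. *)
Lemma OS_IIE i j : OS_II rint log2f b T1 T2 A B i j
  = 2 ^ (- mu i) * CC i j * 2 ^ (- nu j).
Proof.
have h := is_fp_CRT i j; rewrite mxE (fl_fp (is_fpZ _ h)) fl_fp //.
by rewrite mulrC; apply/is_fpZ/is_fpZ.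
Qed.

Lemma CRT_err i j :
  `|CC i j - ((Ai *m Bi) i j)%:~R| <= Rbound R N b Ai Bi i j.
Proof.
have hM : `|((Ai *m Bi) i j)%:~R| <= P / 2 - 2 * 2 ^- 28 * P.
  (* If [Cbar] vanishes here, the shifts may be arbitrary, but [product_le] multiplies them by 0. *)
  have [C0|] := ltP 0 (Cbar A B i j); first exact: product_lt_half.
  move=> C0; have {}C0 : Cbar A B i j = 0.
    by apply/le_anti; rewrite C0; case/andP: (Cbar_bounds i j).
  apply: le_trans (product_le i j) _; rewrite C0 mulr0.
  by have P0 : 0 <= P by []; move: P P0 => p; lra.
have N49 : (N <= 49)%N by case/andP: hN.
have hw l : `|w i j l| <= (modulus l %/ 2)%:Z := W_le hrint N49 Ai Bi l i j.
have [q hq] := crt_congr N49 (fun l => W_dvd hrint N49 hk Ai Bi l i j).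
have h32 := crt_entry32_err hrint hN T2 hT1 hw hq hM.
have h64 := crt_entry64_err hrint hN hT1 hT2 hw hq hM.
rewrite /CRT; case: (b).
  rewrite Rbound32E mxE CRT64E -!mulrA.
  by apply: single_rounding_err; rewrite !mulrA.
(* The error bound just proved has coefficient 1 where [Rbound] has [1 + 3 u]. *)
rewrite Rbound64E CRT64E; apply: le_trans h64 _; rewrite lerD2r.
set x := 2 ^ _; have x0 : 0 <= x by exact/ltW/pow2_gt0.
have u0 := ltW (unit_roundoff_gt0 R FP64); move: (unit_roundoff FP64) u0 => u u0.
have -> : (N%:R + 2) * u * (x * u * (rho N)%:R * P)
  = x * (N%:R + 2) * u ^+ 2 * (rho N)%:R * P by ring.
rewrite -!mulrA [(1 + 3 * u) * _]mulrDl mul1r lerDl.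
by rewrite !mulr_ge0 ?addr_ge0 ?exprn_ge0.
Qed.

(** [Cbar i j] is a sum of nonnegative products, so for each [h] one of the two factors is 0. A zero
    ceiling forces the underlying entry of [A] or [B] to be 0, and zeros pass through every
    operation exactly. *)
Lemma zero_entry i j : Cbar A B i j = 0 ->
  (A *m B) i j = 0 /\ OS_II rint log2f b T1 T2 A B i j = 0.
Proof.
move=> C0; have AB0 h : Abar A i h = 0 \/ Bbar B h j = 0.
  have /eqP := C0; rewrite mxE psumr_eq0 => [|h' _]; last first.
    rewrite mulr_ge0 //; first by case/andP: (Abar_bounds i h').
    by case/andP: (Bbar_bounds h' j).
  move=> /allP/(_ h (mem_index_enum _)); rewrite mulf_eq0.
  by move=> /orP[]/eqP; [left|right].
have A0 h : Abar A i h = 0 -> A i h = 0.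
  rewrite mxE => /eqP; have := ceil_ge (2 ^ mu' A i * `|A i h|).
  move=> + /eqP E; rewrite E pmulr_rle0 ?pow2_gt0 // normr_le0.
  by move/eqP.
have B0 h : Bbar B h j = 0 -> B h j = 0.
  rewrite mxE => /eqP; have := ceil_ge (`|B h j| * 2 ^ nu' B j).
  move=> + /eqP E; rewrite E pmulr_lle0 ?pow2_gt0 // normr_le0.
  by move/eqP.
split.
  rewrite mxE big1 // => h _.
  by have [/A0 ->|/B0 ->] := AB0 h; rewrite ?mul0r ?mulr0.
have rt0 : rtrunc (0 : R) = 0 by rewrite /rtrunc lexx floor0.
have w0 l : w i j l = 0.
  apply: W_eq0 => // h; rewrite !mxE.
  by have [/A0 ->|/B0 ->] := AB0 h; rewrite ?mul0r ?mulr0 rt0 ?mul0r ?mulr0.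
have s0 T c : fl_sum FP64 T (fun l : 'I_N => fl FP64 (c l * (w i j l)%:~R)) = 0 :> R.
  rewrite -[RHS](fl_sum0 R FP64 T); apply: eq_fl_sum => l.
  by rewrite w0 mulr0 fl0.
have r0 : rint 0 = 0 by apply: rint_near => //; rewrite subrr normr0; lra.
have e0 c : crt_entry rint T1 T2 (w i j) c = 0.
  by rewrite /crt_entry !s0 mulr0 fl0 r0 oppr0 /fma !mul0r !addr0 !fl0 ?add0r ?fl0.
rewrite OS_IIE (_ : CC i j = 0) ?mulr0 ?mul0r //.
by rewrite /CRT; case: (b); [rewrite mxE CRT64E e0 fl0|rewrite CRT64E e0].
Qed.

End Entry.

(** * Assembly of the bound *)

Lemma entry_err_arith (R : realType) (k AB M cc s s' ta tb SA SB r : R) :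
  0 < s -> 0 < s' -> s <= ta -> s' <= tb -> 0 <= SA -> 0 <= SB -> 0 <= k ->
  `|AB - s * s' * M| <= s' * SA + s * SB + k * (s * s') -> `|cc - M| <= r ->
  `|AB - s * cc * s'| <= SA * tb + ta * SB + (k + r) * (ta * tb).
Proof.
move=> s0 s0' hs hs' SA0 SB0 k0 h1 h2.
have r0 : 0 <= r := le_trans (normr_ge0 _) h2.
have ss0 : 0 <= s * s' by rewrite mulr_ge0 ?ltW.
have h3 : `|s * s' * M - s * cc * s'| <= s * s' * r.
  have -> : s * s' * M - s * cc * s' = s * s' * (M - cc) by ring.
  by rewrite normrM ger0_norm // ler_wpM2l // distrC.
apply: le_trans (ler_distD (s * s' * M) _ _) _.
have h4 : s * s' <= ta * tb by rewrite ler_pM // ltW.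
have h5 : (k + r) * (s * s') <= (k + r) * (ta * tb) by rewrite ler_wpM2l ?addr_ge0.
have h6 : SA * s' <= SA * tb by rewrite ler_wpM2l.
have h7 : s * SB <= ta * SB by rewrite ler_wpM2r.
lra.
Qed.

(** Each [al] and [be] is paired with one factor [t], since [t * al i 0] and [t * be j 0] are the
    bounds for the inverse scalings. *)
Lemma bound_entryE (R : realType) m k n (A : 'M[R]_(m, k)) (B : 'M_(k, n))
    (D : 'M_(m, n)) (al : 'cV_m) (be : 'cV_n) (t : R) i j :
  (t *: (absmx A *m (const_mx 1 : 'cV_k) *m be^T)
   + t *: (al *m (const_mx 1 : 'cV_k)^T *m absmx B)
   + hadamard (k%:R *: const_mx 1 + D) (t ^+ 2 *: (al *m be^T))) i j
  = (\sum_h `|A i h|) * (t * be j 0) + (t * al i 0) * (\sum_h `|B h j|)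
    + (k%:R + D i j) * ((t * al i 0) * (t * be j 0)).
Proof.
rewrite -[al *m _ *m _]mulmxA !mxE !big_ord1 !mxE.
under eq_bigr do rewrite !mxE mulr1.
under [X in al i 0 * X]eq_bigr do rewrite !mxE mul1r.
ring.
Qed.

Theorem theorem2 (R : realType) (rint : R -> int) (log2f : R -> R)
    (b : format) (N m k n : nat) (T1 T2 : sum_tree 'I_N)
    (A : 'M[R]_(m, k)) (B : 'M[R]_(k, n))
    (hrint : nearest_int rint) (hlog2f : log2f_accurate log2f)
    (hT1 : sum_order T1) (hT2 : sum_order T2)
    (hN : (2 <= N <= 49)%N) (hk : (k <= 2 ^ 17)%N)
    (hA : forall i h, is_fp (prec b) (A i h))
    (hB : forall h j, is_fp (prec b) (B h j))
    (hA0 : forall i, row i A != 0) (hB0 : forall j, col j B != 0) :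
  let C := OS_II rint log2f b T1 T2 A B in
  let A' := Aint log2f N A B in
  let B' := Bint log2f N A B in
  let v : 'cV[R]_k := const_mx 1 in
  let E : 'M[R]_(m, n) := const_mx 1 in
  let t : R := 1 / Num.sqrt (2 ^+ 5 * ((Pprod N)%:R - 1)) in
  let alpha := pow2 (alpha' A B) in
  let beta := pow2 (beta' A B) in
  forall (i : 'I_m) (j : 'I_n),
    absmx (A *m B - C) i j <=
    (t *: (absmx A *m v *m beta^T)
     + t *: (alpha *m v^T *m absmx B)
     + hadamard (k%:R *: E + Rbound R N b A' B')
                (t ^+ 2 *: (alpha *m beta^T))) i j.

Proof.
move=> C A' B' v E t al be i j.
have t0 : 0 <= t by rewrite divr_ge0 ?sqrtr_ge0.
have SA0 : 0 <= \sum_h `|A i h| by rewrite sumr_ge0.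
have SB0 : 0 <= \sum_h `|B h j| by rewrite sumr_ge0.
have al0 : 0 <= al i 0 by rewrite /al mxE powR_ge0.
have be0 : 0 <= be j 0 by rewrite /be mxE powR_ge0.
have hR := CRT_err b A B hrint hlog2f hT1 hT2 hN hk i j.
rewrite bound_entryE.
have absE (X Y : 'M[R]_(m, n)) : absmx (X - Y) i j = `|X i j - Y i j|.
  by rewrite !mxE.
rewrite absE.
have [C0|C0] := ltP 0 (Cbar A B i j).
  rewrite /C OS_IIE //.
  have hs := inverse_scaling_row_le hlog2f hN hk C0.
  have hs' := inverse_scaling_col_le hlog2f hN hk C0.
  apply: (entry_err_arith (pow2_gt0 R _) (pow2_gt0 R _) hs hs' SA0 SB0 _ _ hR) => //.
  rewrite [(A *m B) i j]mxE [(_ *m _) i j]mxE.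
  apply: scaled_product_err => h; rewrite mxE ?[B h j * _]mulrC;
    exact: scaled_trunc_err.
(* Here the inverse scalings may be uncontrolled, but the left side is 0 and the bound is
   nonnegative; for [Rbound] this follows as it dominates an absolute value. *)
have {}C0 : Cbar A B i j = 0.
  by apply/le_anti; rewrite C0; case/andP: (Cbar_bounds A B hk i j).
have [-> ->] := zero_entry log2f b T1 T2 hrint C0.
have r0 := le_trans (normr_ge0 _) hR.
have := mulr_ge0 t0 al0; have := mulr_ge0 t0 be0.
move: (t * al i 0) (t * be j 0) => ta tb tb0 ta0.
by rewrite subrr normr0 !addr_ge0 // mulr_ge0 // ?addr_ge0 // mulr_ge0.
Qed.
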